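(* Let $\alpha_1,\beta_1,\alpha_2,\beta_2\in L^\infty$. Then $S_{\alpha_1,\beta_1}S_{\alpha_2,\beta_2}=S_{\alpha,\beta}$ for some $\alpha,\beta\in L^\infty$ if and only if either $\alpha_1=\beta_1$, or ($\alpha_2$ is analytic and $\beta_2$ is co-analytic). In that case $\alpha=\alpha_1\alpha_2$ and $\beta=\beta_1\beta_2$.
   Context: $S^1=\{z\in\mathbb{C}:|z|=1\}$ carries normalized Lebesgue measure; $L^2=L^2(S^1)$, $L^\infty=L^\infty(S^1)$ (complex-valued functions, equality meaning a.e.). $H^2$ is the Hardy space of all $f\in L^2$ whose negative Fourier coefficients vanish, and $H^{2\bot}$ is its orthogonal complement in $L^2$. $P$ and $Q=I-P$ are the orthogonal projections of $L^2$ onto $H^2$ and $H^{2\bot}$. For $\alpha,\beta\in L^\infty$, the operator $S_{\alpha,\beta}$ on $L^2$ is $S_{\alpha,\beta}f=\alpha Pf+\beta Qf$. A function in $L^2$ is analytic if it lies in $H^2$, and co-analytic if its complex conjugate is analytic. *)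

(* Defs.v *)
From HB Require Import structures.
From mathcomp Require Import all_boot all_order all_algebra.
From mathcomp Require Import complex.
From mathcomp Require Import all_classical all_reals all_analysis.
From mathcomp Require Import measurable_realfun.

Set Implicit Arguments.
Unset Strict Implicit.
Unset Printing Implicit Defensive.

Import Order.TTheory GRing.Theory Num.Theory.
Import numFieldNormedType.Exports.

Local Open Scope classical_set_scope.
Local Open Scope ring_scope.
Local Open Scope complex_scope.

Section Circle.
Variable R : realType.

Record circle : Type := Circle {
  circle_val :> R[i];
  circle_valP : `|circle_val| == 1
}.

HB.instance Definition _ := [isSub for circle_val].
HB.instance Definition _ := [Choice of circle by <:].

Fact circle1_subproof : `|1 : R[i]| == 1.
Proof. by rewrite normr1. Qed.

HB.instance Definition _ := isPointed.Build circle (Circle circle1_subproof).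

(* circle carries the Borel sigma-algebra it inherits from the plane R * R. *)
Definition circle_coord (z : circle) : R * R :=
  (complex.Re (z : R[i]), complex.Im (z : R[i])).

Local Notation coordT := (g_sigma_algebra_preimageType circle_coord).

HB.instance Definition _ :=
  @isMeasurable.Build (preimage_display circle_coord) circle
    (g_sigma_algebra_preimage circle_coord)
    (@measurable0 _ coordT) (@measurableC _ coordT)
    (@bigcupT_measurable _ coordT).

Fact circle_exp_subproof (t : R) :
  `|cos (2 * pi * t) +i* sin (2 * pi * t)| == 1.
Proof. by rewrite normc_def /= cos2Dsin2 sqrtr1. Qed.

Definition circle_exp (t : measurableTypeR R) : circle := Circle (circle_exp_subproof t).

Fact measurable_circle_exp : measurable_fun [set: measurableTypeR R] circle_exp.
Proof.
have mlin : measurable_fun [set: R] (fun t : R => 2 * pi * t).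
  exact: measurable_funM.
have mc : measurable_fun [set: R] (circle_coord \o circle_exp).
  apply: (@measurable_fun_pair _ _ _ _ _ _ (fun t : R => cos (2 * pi * t))
    (fun t : R => sin (2 * pi * t))).
    apply: (measurableT_comp _ mlin); apply: continuous_measurable_fun.
    exact: continuous_cos.
  apply: (measurableT_comp _ mlin); apply: continuous_measurable_fun.
  exact: continuous_sin.
by move=> _ _ [B mB <-]; rewrite setTI -comp_preimage; exact: mc.
Qed.

HB.instance Definition _ :=
  isMeasurableFun.Build _ _ _ _ circle_exp measurable_circle_exp.

(* Normalized Lebesgue measure on the circle: the image of Lebesgue measure on
   [0, 1] under t |-> exp (2 i pi t). *)
Definition circle_measure : set circle -> \bar R :=
  distribution (uniform_prob (@ltr01 R)) circle_exp.

HB.instance Definition _ := Probability.on circle_measure.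

End Circle.

Section LebesgueSpaces.
Variable R : realType.
Local Notation S1 := (circle R).
Local Notation mu := (@circle_measure R).
Implicit Types (f g a b : S1 -> R[i]).

(* Elements of L^2 and L^oo are represented by functions; their equality is
   equality almost everywhere. *)
Definition Lcircle (p : \bar R) : set (S1 -> R[i]) :=
  [set f : S1 -> R[i] |
    [/\ measurable_fun [set: S1] (fun z => complex.Re (f z) : R),
        measurable_fun [set: S1] (fun z => complex.Im (f z) : R) &
        finite_norm mu p (fun z => ComplexField.Normc.normc (f z))]].

Definition L2 := Lcircle 2%:E.
Definition Loo := Lcircle +oo%E.

Definition circle_integral f : R[i] :=
  (\int[mu]_z complex.Re (f z)) +i* (\int[mu]_z complex.Im (f z)).

Definition inner f g : R[i] := circle_integral (fun z => f z * (g z)^*).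

Definition fourier f (n : int) : R[i] :=
  circle_integral (fun z => f z * (z : R[i]) ^ (- n)).

Definition H2 : set (S1 -> R[i]) :=
  [set f | L2 f /\ forall n : int, n < 0 -> fourier f n = 0].

Definition H2perp : set (S1 -> R[i]) :=
  [set f | L2 f /\ forall h, H2 h -> inner f h = 0].

(* The orthogonal projections. For f in L^2, projP f is a representative of the
   class, unique up to a.e. equality, of the h in H^2 with f - h orthogonal to
   H^2. *)
Definition projP f : S1 -> R[i] :=
  xget (cst 0) [set h | H2 h /\ H2perp (f \- h)].
Definition projQ f : S1 -> R[i] := f \- projP f.

Definition Sop a b f : S1 -> R[i] := a \* projP f \+ b \* projQ f.

Definition eq_on_L2 (A B : (S1 -> R[i]) -> (S1 -> R[i])) : Prop :=
  forall f, L2 f -> A f = B f %[ae mu].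

Definition analytic f : Prop := H2 f.
Definition coanalytic f : Prop := analytic (fun z => (f z)^*).

End LebesgueSpaces.

(* Main.v *)
(** The products of operators are compared on the characters [e_n(z) = z^n].
    Let [g = Q alpha2] and suppose [alpha1 <> beta1] on a set of positive
    measure. If [z^n g] lies in [H2perp], then so does [z^(n+1) g - c], where
    [c] is the Fourier coefficient of index [-1] of [z^n g], and this gives the
    decompositions of [alpha2 e_n] and [alpha2 e_(n+1)] along [H2 + H2perp].
    Comparing both sides of [S_(alpha1,beta1) S_(alpha2,beta2) = S_(alpha,beta)]
    on [e_n] and on [e_(n+1)] then yields [(alpha1 - beta1) c = 0], so [c = 0],
    and by induction every Fourier coefficient of [g] vanishes: [alpha2] is
    analytic. The argument for [beta2] is the same, with [P (beta2 e_(-1))] and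
    the negative characters.

    Existence of the projections needs the completeness of L^2 (Riesz-Fischer)
    and minimizing sequences. Completeness of the characters is obtained without
    Stone-Weierstrass or Fejer: if all Fourier coefficients of [f] vanish, the
    bounded functions [q] such that multiplication by [q] preserves
    [{p : forall n, \int f p e_n = 0}] form an algebra closed under bounded
    pointwise limits which contains the coordinates [Re z] and [Im z]; hence the
    sets whose indicator belongs to it form a sigma-algebra, which contains the
    half planes, so it contains every Borel set. *)

From mathcomp Require Import all_boot all_order all_algebra.
From mathcomp Require Import complex.
From mathcomp Require Import all_classical all_reals all_analysis.
From mathcomp Require Import measurable_realfun ring lra.
Require Import Defs.

Set Implicit Arguments.
Unset Strict Implicit.
Unset Printing Implicit Defensive.

Import Order.TTheory GRing.Theory Num.Theory.
Import numFieldNormedType.Exports.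

Local Open Scope classical_set_scope.
Local Open Scope ring_scope.

Local Notation Re := complex.Re.
Local Notation Im := complex.Im.
Local Notation normc := ComplexField.Normc.normc.

(** * Completeness of L^2 *)

Section RieszFischer.
Context d (T : measurableType d) (R : realType).
Variable mu : {measure set T -> \bar R}.

(** This is a weighted Cauchy-Schwarz inequality for the telescoping sum: from index [n] on, the
    numbers [2 ^- i] add up to at most [2 * 2 ^- n]. The induction peels off the first increment
    with [(x + y)^2 <= 2 x^2 + 2 y^2]; the weight [2 ^+ i] pays for the factor 2 lost each time. *)
Lemma telescope_sqr_le (u : nat -> R) (n k : nat) :
  (u (n + k)%N - u n) ^+ 2 <=
  2 * 2 ^- n * \sum_(n <= i < n + k) 2 ^+ i * (u i.+1 - u i) ^+ 2.
Proof.
elim: k n => [|k IH] n.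
  by rewrite addn0 subrr expr0n /= big_geq// mulr0.
have nk : (n < n + k.+1)%N by rewrite addnS ltnS leq_addr.
rewrite big_ltn// addnS; have := IH n.+1; rewrite addSn.
set S := \sum_(_ <= i < _) _; set a := u _.+1; set b := u n.+1; set c := u n.
rewrite (exprS 2 n) invfM => h.
have p0 : (2 : R) ^+ n != 0 by rewrite expf_neq0.
have -> : 2 * 2 ^- n * (2 ^+ n * (b - c) ^+ 2 + S) =
   2 * (b - c) ^+ 2 + 2 * (2 ^- n * S).
  by field.
have {h} : (a - b) ^+ 2 <= 2 ^- n * S.
  by apply: le_trans h _; rewrite mulrA divff// mul1r.
set X := 2 ^- n * S => h; apply: (@le_trans _ _ (2 * (a - b) ^+ 2 + 2 * (b - c) ^+ 2)).
  rewrite -subr_ge0 (_ : _ - _ = ((a - b) - (b - c)) ^+ 2) ?sqr_ge0//; ring.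
by rewrite addrC lerD2l ler_pM2l.
Qed.

(** The rate [4 ^- n] leaves room for the weights [2 ^+ k]: the weighted squared increments have
    integrals at most [2 ^- k], so their sum [W] has integral at most 2. Integrating the pointwise
    bound [2 * 2 ^- n * W] then gives the stated constant 4. *)
Lemma riesz_fischer (u : nat -> T -> R) :
  (forall n, measurable_fun setT (u n)) ->
  (forall n, \int[mu]_x ((u n.+1 x - u n x) ^+ 2)%:E <= (4 ^- n)%:E)%E ->
  exists2 v : T -> R, measurable_fun setT v &
    forall n, (\int[mu]_x ((v x - u n x) ^+ 2)%:E <= (4 * 2 ^- n)%:E)%E.
Proof.
move=> mu_ hu.
(* [W] is integrable and dominates: [(u m - u n)^2 <= 2 * 2^-n * W] for
   [n <= m], so [u] converges wherever [W] is finite. *)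
pose w k x := 2 ^+ k * (u k.+1 x - u k x) ^+ 2.
have w0 k x : 0 <= w k x by apply: mulr_ge0; [exact: exprn_ge0|exact: sqr_ge0].
have mw k : measurable_fun setT (w k).
  by apply: measurable_funM => //; apply: measurable_funX; apply: measurable_funB.
pose W x := (\sum_(k <oo) (w k x)%:E)%E.
have mW : measurable_fun setT W.
  apply: ge0_emeasurable_sum => //; first by move=> k x _ _; rewrite lee_fin.
  by move=> k _; apply/measurable_EFinP.
have W0 x : (0 <= W x)%E by apply: nneseries_ge0 => k _ _; rewrite lee_fin.
have leW n x k : ((\sum_(n <= i < k) w i x)%:E <= W x)%E.
  have sub : \sum_(n <= i < k) w i x <= \sum_(0 <= i < k) w i x.
    have [nk|kn] := leqP n k; last by rewrite big_geq ?sumr_ge0// ltnW.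
    by rewrite (@big_cat_nat _ _ _ n 0 k)//= lerDr sumr_ge0.
  apply: (@le_trans _ _ (\sum_(0 <= i < k) w i x)%:E); first by rewrite lee_fin.
  rewrite -sumEFin; apply: nneseries_lim_ge => i _ _; rewrite lee_fin//.
have intW : (\int[mu]_x W x <= 2%:E)%E.
  rewrite integral_nneseries//; last first.
    by move=> n x _; rewrite lee_fin.
    by move=> n; apply/measurable_EFinP.
  have h k : (\int[mu]_x (w k x)%:E <= (2 ^- k)%:E)%E.
    under eq_integral do rewrite EFinM.
    rewrite ge0_integralZl_EFin//; last 2 first.
      by move=> x _; rewrite lee_fin sqr_ge0.
      by apply/measurable_EFinP; apply: measurable_funX; apply: measurable_funB.
    have -> : (2 ^- k : R) = 2 ^+ k * 4 ^- k.
      rewrite [4](_ : _ = 2 * 2)// ?exprMn ?invfM; last by ring.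
      by rewrite mulrA divff ?mul1r// expf_neq0.
    by rewrite EFinM lee_wpmul2l// lee_fin exprn_ge0.
  apply: (@le_trans _ _ (\sum_(k <oo) (2 ^- k)%:E)%E).
    by apply: lee_nneseries => [k _ _|k _]; [apply: integral_ge0 => x _; rewrite lee_fin|exact: h].
  apply: lime_le.
    by apply: is_cvg_nneseries => n _ _; rewrite lee_fin invr_ge0 exprn_ge0.
  apply: nearW => n; rewrite sumEFin lee_fin.
  suff : \sum_(0 <= i < n) 2 ^- i = 2 - 2 * 2 ^- n :> R.
    by move=> ->; rewrite lerBlDr lerDl mulr_ge0// invr_ge0 exprn_ge0.
  elim: n => [|n IH]; first by rewrite big_geq// expr0 invr1; ring.
  rewrite big_nat_recr//= IH exprS; field.
  by rewrite expf_neq0.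
pose E := [set x | (W x < +oo)%E].
have mE : measurable E.
  by rewrite /E -[X in measurable X]setTI; apply: emeasurable_fun_infty_o.
(* Cutting [u] off where [W] is infinite makes the sequence converge everywhere, so the limit is
   measurable; outside [E] the bound by [W] is trivial. *)
pose z n x := u n x * \1_E x.
have zcvg x : cvgn (z ^~ x).
  have [Ex|nEx] := pselect (E x); last first.
    suff -> : z ^~ x = cst 0 by exact: is_cvg_cst.
    by apply/funext => n; rewrite /z indicE memNset// mulr0.
  have Wx : W x = (fine (W x))%:E by rewrite fineK// ge0_fin_numE.
  have bnd n m : (n <= m)%N -> (z m x - z n x) ^+ 2 <= 2 * 2 ^- n * fine (W x).
    move=> nm; rewrite /z indicE mem_set// !mulr1 -(subnKC nm).
    apply: le_trans (telescope_sqr_le (u ^~ x) _ _) _.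
    apply: ler_wpM2l; first by rewrite mulr_ge0// invr_ge0 exprn_ge0.
    by rewrite -lee_fin -Wx; apply: leW.
  apply/cauchy_cvgP/cauchy_exP => e e0 /=.
  have [N HN] : exists N, 2 * 2 ^- N * fine (W x) < (e / 2) ^+ 2.
    have : (fun n => 2 * fine (W x) * (2^-1) ^+ n) @ \oo --> 2 * fine (W x) * 0.
      apply: cvgM; first exact: cvg_cst.
      by apply: cvg_expr; rewrite ger0_norm ?invr_ge0// invf_lt1// ltr1n.
    rewrite mulr0 => /cvgrPdist_lt /(_ ((e / 2) ^+ 2)).
    move=> /(_ _)[]; first by rewrite exprn_gt0// divr_gt0.
    move=> N _ /(_ N (leqnn _)) /=.
    rewrite sub0r normrN => h; exists N.
    by rewrite mulrAC -exprVn; apply: le_lt_trans h; exact: ler_norm.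
  exists (z N x); exists N => // q /= Nq.
  have dist : `|z q x - z N x| < e / 2.
    rewrite -(@ltr_pXn2r _ 2) ?nnegrE//; last by rewrite divr_ge0// ltW.
    by rewrite real_normK ?num_real// (le_lt_trans (bnd _ _ Nq)).
  by rewrite /ball /= distrC (lt_trans dist)// ltr_pdivrMr// ltr_pMr// ltr1n.
pose v x := limn (z ^~ x).
have mz n : measurable_fun setT (z n).
  by apply: measurable_funM => //; exact: measurable_indic.
have mv : measurable_fun setT v.
  by apply: (measurable_fun_cvg mz) => x _; exact: zcvg.
exists v => // n.
have vW x : (((v x - u n x) ^+ 2)%:E <= (2 * 2 ^- n)%:E * W x)%E.
  have p0 : 0 < 2 * 2 ^- n :> R by rewrite mulr_gt0// invr_gt0 exprn_gt0.
  have [Ex|nEx] := pselect (E x); last first.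
    have -> : W x = +oo%E.
      by apply/eqP; rewrite eq_le leey/= leNgt; apply/negP.
    by rewrite gt0_muley ?leey// lte_fin.
  have Wx : W x = (fine (W x))%:E by rewrite fineK// ge0_fin_numE.
  rewrite Wx -EFinM lee_fin.
  have c : (fun m => (z m x - u n x) ^+ 2) @ \oo --> (v x - u n x) ^+ 2.
    have h : (fun m => z m x - u n x) @ \oo --> v x - u n x.
      by apply: cvgB; [exact: zcvg|exact: cvg_cst].
    by rewrite expr2; under eq_cvg do rewrite expr2; exact: cvgM.
  rewrite -(cvg_lim _ c)//; apply: limr_le; first by apply/cvg_ex; eexists; exact: c.
  exists n => // m /= nm.
  rewrite /z indicE mem_set// !mulr1 -(subnKC nm).
  apply: le_trans (telescope_sqr_le (u ^~ x) _ _) _.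
  apply: ler_wpM2l; first exact: ltW.
  by rewrite -lee_fin -Wx; apply: leW.
apply: (@le_trans _ _ (\int[mu]_x ((2 * 2 ^- n)%:E * W x))%E).
  apply: ge0_le_integral => //.
  - by move=> x _; rewrite lee_fin sqr_ge0.
  - by apply/measurable_EFinP; apply: measurable_funX; apply: measurable_funB.
  - by apply: measurable_funeM.
rewrite ge0_integralZl_EFin//.
apply: (@le_trans _ _ ((2 * 2 ^- n)%:E * 2%:E)%E).
  by rewrite lee_wpmul2l// lee_fin mulr_ge0// invr_ge0 exprn_ge0.
by rewrite -EFinM lee_fin le_eqVlt (_ : 2 * 2 ^- n * 2 = 4 * 2 ^- n) ?eqxx//; ring.
Qed.

End RieszFischer.

(** * Multipliers of the annihilator of a family of functions *)

Section StepPolynomials.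
Variable R : realType.
Implicit Types r s t : R.

Lemma bernoulli_le s n : -1 <= s -> 1 + n%:R * s <= (1 + s) ^+ n.
Proof.
move=> s1; elim: n => [|n IH]; first by rewrite mul0r addr0 expr0.
have s0 : 0 <= 1 + s by rewrite addrC -lerBlDr sub0r.
rewrite exprS; apply: le_trans (ler_wpM2l s0 IH).
rewrite -natr1 -subr_ge0 (_ : _ - _ = n%:R * s ^+ 2); last by ring.
by rewrite mulr_ge0// sqr_ge0.
Qed.

(** With [q = sqrt r] and [h = 1/q - 1 > 0], Bernoulli's inequality gives [n h <= q^-n]; squaring,
    [r^n = q^(2n) <= 1 / (n h)^2], so that [n r^n <= 1 / (n h^2)]. *)
Lemma cvg_natr_expr r : 0 <= r < 1 -> (fun n => n%:R * r ^+ n) @ \oo --> 0.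
Proof.
move=> /andP[r0 r1]; have [->|rn0] := eqVneq r 0.
  rewrite (_ : (fun n => _) = cst 0); first exact: cvg_cst.
  by apply/funext => -[|n]; rewrite ?mul0r// expr0n mulr0.
have rp : 0 < r by rewrite lt_def rn0.
pose q := Num.sqrt r; pose h := q^-1 - 1.
have q0 : 0 < q by rewrite sqrtr_gt0.
have q1 : q < 1 by rewrite -sqrtr1 ltr_sqrt.
have h0 : 0 < h by rewrite subr_gt0 invf_gt1.
have bnd n : n%:R * r ^+ n <= n%:R^-1 * h ^- 2.
  case: n => [|n]; first by rewrite mul0r invr0 mul0r.
  have n0 : 0 < n.+1%:R :> R by [].
  have : n.+1%:R * h <= q ^- n.+1.
    have := @bernoulli_le h n.+1 (le_trans (lerN10 _) (ltW h0)).
    have -> : 1 + h = q^-1 by rewrite /h addrC subrK.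
    by rewrite exprVn; apply: le_trans; rewrite lerDr.
  rewrite -[q ^- n.+1]mul1r ler_pdivlMr ?exprn_gt0// => b.
  have nh : 0 < n.+1%:R * h by rewrite mulr_gt0.
  have : q ^+ n.+1 <= (n.+1%:R * h)^-1.
    by rewrite -[leRHS]mulr1 ler_pdivlMl.
  move=> {}b; have -> : r ^+ n.+1 = (q ^+ n.+1) ^+ 2.
    by rewrite -exprM mulnC exprM sqr_sqrtr.
  have -> : n.+1%:R^-1 * h ^- 2 = n.+1%:R * ((n.+1%:R * h)^-1) ^+ 2.
    by rewrite exprVn; field; rewrite !gt_eqF.
  rewrite ler_pM2l// ler_pXn2r// nnegrE; first by rewrite exprn_ge0// ltW.
  by rewrite invr_ge0 ltW.
apply: (@squeeze_cvgr _ _ _ _ (cst 0) (fun n => n%:R^-1 * h ^- 2)).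
- by apply: nearW => n; rewrite bnd /= mulr_ge0// exprn_ge0.
- exact: cvg_cst.
- rewrite -[X in _ --> X](mul0r (h ^- 2)); apply: cvgMl.
  apply/gtr0_cvgV0; first by exists 1%N => // n /=; rewrite ltr0n.
  exact: cvgr_idn.
Qed.

(* Bernoulli's inequality bounds [step_poly n t] between [1 - n (2 t)^n] and
   [1 / (1 + n (2 t)^n)]; the factor [n] of the exponent makes the limit at the
   threshold [t = 1/2] equal to [0]. *)
Definition step_poly (n : nat) t := (1 - t ^+ n) ^+ (n * 2 ^ n).

Lemma step_poly_itv n t : 0 <= t <= 1 -> 0 <= step_poly n t <= 1.
Proof.
move=> /andP[t0 t1]; have : 0 <= t ^+ n <= 1 by rewrite exprn_ge0// exprn_ile1.
move=> /andP[a b]; apply/andP; split; first by rewrite exprn_ge0// subr_ge0.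
by rewrite exprn_ile1// ?subr_ge0// gerBl.
Qed.

Lemma step_poly_cvg t : 0 <= t <= 1 ->
  step_poly ^~ t @ \oo --> ((t < 2^-1)%R%:R : R).
Proof.
move=> t01; have /andP[t0 t1] := t01; have [th|th] := ltP t 2^-1.
  apply: (@squeeze_cvgr _ _ _ _ (fun n => 1 - n%:R * (2 * t) ^+ n) (cst 1)).
  - apply: nearW => n; have /andP[_ ->] := step_poly_itv n t01; rewrite andbT.
    have := @bernoulli_le (- t ^+ n) (n * 2 ^ n).
    rewrite lerN2 exprn_ile1// => /(_ isT); apply: le_trans.
    by rewrite exprMn mulrN natrM natrX mulrA.
  - rewrite -[X in _ --> X]subr0; apply: cvgB; first exact: cvg_cst.
    apply: cvg_natr_expr; rewrite mulr_ge0//=.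
    by rewrite -ltr_pdivlMl// mulr1.
  - exact: cvg_cst.
apply: (@squeeze_cvgr _ _ _ _ (cst 0) (fun n => n.+1%:R^-1)).
- apply: nearW => n; have /andP[-> _] := step_poly_itv n t01 => /=.
  set s := t ^+ n; set N := (n * 2 ^ n)%N.
  have s0 : 0 <= s by rewrite exprn_ge0.
  have s1 : s <= 1 by rewrite exprn_ile1.
  have b := @bernoulli_le s N (le_trans (lerN10 _) s0).
  have nN : n.+1%:R <= 1 + N%:R * s.
    rewrite -natr1 addrC lerD2l /N natrM natrX -mulrA -exprMn.
    rewrite ler_peMr// exprn_ege1// -ler_pdivrMl// mulr1//.
  (* Since [(1 - s) (1 + s) <= 1], the power of [1 - s] is at most the inverse of the power of
     [1 + s], and Bernoulli's inequality makes the latter at least [n + 1]. *)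
  have p : (1 - s) ^+ N * (1 + s) ^+ N <= 1.
    rewrite -exprMn exprn_ile1//.
      by rewrite mulr_ge0 ?subr_ge0// addr_ge0.
    have := sqr_ge0 s; nra.
  rewrite -[leRHS]mul1r ler_pdivlMr//.
  apply: le_trans p; rewrite ler_wpM2l ?exprn_ge0 ?subr_ge0//.
  exact: le_trans b.
- exact: cvg_cst.
- exact: cvg_harmonic.
Qed.

End StepPolynomials.

(** * The algebra of multipliers and its sigma-algebra of sets *)

Section Multipliers.
Context d (T : measurableType d) (R : realType).
Variable mu : {finite_measure set T -> \bar R}.
Variable W : set (T -> R).
Hypothesis iW : forall w, W w -> mu.-integrable setT (EFin \o w).

Definition bounded_meas (p : T -> R) :=
  measurable_fun setT p /\ exists M, forall x, `|p x| <= M.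

Definition annihilator (p : T -> R) :=
  bounded_meas p /\ forall w, W w -> \int[mu]_x (p x * w x) = 0.

(** Preserving the annihilator, unlike belonging to it, is stable under products; polynomials in a
    multiplier are therefore multipliers. *)
Definition multiplier (q : T -> R) :=
  bounded_meas q /\ forall p, annihilator p -> annihilator (fun x => q x * p x).

Lemma bounded_measD p q : bounded_meas p -> bounded_meas q ->
  bounded_meas (fun x => p x + q x).
Proof.
move=> [mp [M HM]] [mq [K HK]]; split; first exact: measurable_funD.
by exists (M + K) => x; apply: le_trans (ler_normD _ _) _; exact: lerD.
Qed.

Lemma bounded_measM p q : bounded_meas p -> bounded_meas q ->
  bounded_meas (fun x => p x * q x).
Proof.
move=> [mp [M HM]] [mq [K HK]]; split; first exact: measurable_funM.
by exists (M * K) => x; rewrite normrM ler_pM.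
Qed.

Lemma bounded_meas_cst c : bounded_meas (cst c).
Proof. by split; [exact: measurable_cst|exists `|c|]. Qed.

Lemma integrable_bounded_meas p w : bounded_meas p -> W w ->
  mu.-integrable setT (EFin \o (fun x => p x * w x)).
Proof.
move=> [mp [M HM]] /iW iw.
apply: (le_integrable measurableT _ _ (integrableZl measurableT M iw)).
  apply/measurable_EFinP; apply: measurable_funM => //.
  exact/measurable_EFinP/(measurable_int _ iw).
move=> x _; rewrite /= lee_fin !normrM ler_wpM2r//.
exact: le_trans (HM x) (ler_norm _).
Qed.

Lemma annihilatorD p q : annihilator p -> annihilator q ->
  annihilator (fun x => p x + q x).
Proof.
move=> [bp p0] [bq q0]; split=> [|w Ww]; first exact: bounded_measD.
under eq_Rintegral do rewrite mulrDl.
by rewrite RintegralD ?p0 ?q0 ?addr0//; exact: integrable_bounded_meas.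
Qed.

Lemma annihilatorZ c p : annihilator p -> annihilator (fun x => c * p x).
Proof.
move=> [bp p0]; split=> [|w Ww].
  by apply: bounded_measM => //; exact: bounded_meas_cst.
under eq_Rintegral do rewrite -mulrA.
by rewrite RintegralZl ?p0 ?mulr0//; exact: integrable_bounded_meas.
Qed.

Lemma multiplier_cst c : multiplier (cst c).
Proof. by split=> [|p]; [exact: bounded_meas_cst|exact: annihilatorZ]. Qed.

Lemma multiplierD p q : multiplier p -> multiplier q ->
  multiplier (fun x => p x + q x).
Proof.
move=> [bp hp] [bq hq]; split=> [|r ar]; first exact: bounded_measD.
by under eq_fun do rewrite mulrDl; apply: annihilatorD; [exact: hp|exact: hq].
Qed.

Lemma multiplierM p q : multiplier p -> multiplier q ->
  multiplier (fun x => p x * q x).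
Proof.
move=> [bp hp] [bq hq]; split=> [|r ar]; first exact: bounded_measM.
by under eq_fun do rewrite -mulrA; apply: hp; exact: hq.
Qed.

Lemma multiplierZ c p : multiplier p -> multiplier (fun x => c * p x).
Proof. by apply: multiplierM; exact: multiplier_cst. Qed.

Lemma multiplierX p n : multiplier p -> multiplier (fun x => p x ^+ n).
Proof.
move=> mp; elim: n => [|n IH]; first exact: multiplier_cst.
by under eq_fun do rewrite exprS; exact: multiplierM.
Qed.

Lemma multiplierC p : multiplier p -> multiplier (fun x => 1 - p x).
Proof.
move=> mp; under eq_fun do rewrite -mulN1r.
by apply: multiplierD; [exact: multiplier_cst|exact: multiplierZ].
Qed.

(** Dominated convergence, with dominating function [M * |p w|], carries the vanishing integrals to
    the limit. *)
Lemma multiplier_lim (q : nat -> T -> R) (r : T -> R) M :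
  (forall n, multiplier (q n)) -> (forall n x, `|q n x| <= M) ->
  (forall x, q ^~ x @ \oo --> r x) -> multiplier r.
Proof.
move=> mq qM qr.
have mr : measurable_fun setT r.
  by apply: (measurable_fun_cvg (h := q)) => [n|x _]; [exact: (mq n).1.1|exact: qr].
have br : bounded_meas r.
  split => //; exists M => x.
  have c : (fun n => `|q n x|) @ \oo --> `|r x| by apply: cvg_norm; exact: qr.
  rewrite -(cvg_lim _ c)//; apply: limr_le; first by apply/cvg_ex; eexists; exact: c.
  exact: nearW.
split => // p ap; have bp := ap.1; split=> [|w Ww]; first exact: bounded_measM.
have mp := bp.1.
have ipw := integrable_bounded_meas bp Ww.
have mpw : measurable_fun setT (fun x => p x * w x).
  exact/measurable_EFinP/(measurable_int _ ipw).
have : (\int[mu]_x (q n x * (p x * w x))%:E @[n --> \oo] -->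
    \int[mu]_x (r x * (p x * w x))%:E)%E.
  apply: (@dominated_cvg _ _ _ mu setT measurableT
    (fun n x => (q n x * (p x * w x))%:E) _ (fun x => (M * `|p x * w x|)%:E)).
  - move=> n; apply/measurable_EFinP; apply: measurable_funM => //.
    exact: (mq n).1.1.
  - move=> x _; apply: cvg_EFin; first exact: nearW.
    by apply: cvgMl; exact: qr.
  - by [].
  - apply: (integrableZl measurableT M (f := fun x => `|p x * w x|%:E)).
    exact: integrable_norm.
  - by move=> n x _; rewrite abse_EFin lee_fin normrM ler_wpM2r.
(* [Rintegral] sends infinite values to 0 as well, so integrability is what turns a zero real
   integral into a zero extended one. *)
have E n : (\int[mu]_x (q n x * (p x * w x))%:E = 0)%E.
  have [bqp qp0] := (mq n).2 _ ap.
  have := qp0 _ Ww; under eq_Rintegral do rewrite -mulrA.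
  rewrite /Rintegral => e; rewrite -[LHS]fineK ?e//.
  apply: integrable_fin_num => //; have := integrable_bounded_meas bqp Ww.
  by congr integrable; apply/funext => x; rewrite /= mulrA.
under eq_cvg do rewrite E.
move=> /cvg_lim; rewrite lim_cst// => /(_ _)/esym e.
under eq_Rintegral do rewrite -mulrA.
by rewrite /Rintegral e.
Qed.

(** An affine change of variable takes the values of [X] into [[0, 1]] and the threshold [a] to
    [1/2]. The step polynomials in the new variable are multipliers bounded by 1, and they converge
    pointwise to the indicator. *)
Lemma multiplier_lt X a : multiplier X -> (forall x, `|X x| <= 1) ->
  multiplier \1_[set x | X x < a].
Proof.
move=> mX X1.
(* Since [|X - a| <= 1 + |a|], dividing by twice that bound keeps the result within [1/2] of 0. *)
have k0 : 0 < 2 * (1 + `|a|) by rewrite mulr_gt0// ltr_wpDr.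
pose t x := (2 * (1 + `|a|))^-1 * (X x + - a) + 2^-1.
have t01 x : 0 <= t x <= 1.
  have : `|(2 * (1 + `|a|))^-1 * (X x + - a)| <= 2^-1.
    rewrite normrM gtr0_norm ?invr_gt0// ler_pdivrMl// mulrAC divff// mul1r.
    by apply: le_trans (ler_normB _ _) _; rewrite lerD2r.
  rewrite ler_norml /t => /andP[? ?]; apply/andP; split; lra.
have mt : multiplier t.
  apply: multiplierD; last exact: multiplier_cst.
  by apply: multiplierZ; apply: multiplierD => //; exact: multiplier_cst.
apply: (@multiplier_lim (fun n x => step_poly n (t x)) _ 1).
- by move=> n; apply/multiplierX/multiplierC/multiplierX.
- by move=> n x; have /andP[? ?] := step_poly_itv n (t01 x); rewrite ger0_norm.
move=> x; have := step_poly_cvg (t01 x).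
suff -> : (t x < 2^-1)%R%:R = \1_[set x | X x < a] x :> R by [].
rewrite indicE; congr ((nat_of_bool _)%:R).
have -> : (t x < 2^-1) = (X x < a).
  by rewrite /t -ltrBrDr subrr pmulr_rlt0 ?invr_gt0// subr_lt0.
by apply/idP/idP; rewrite inE.
Qed.

Definition multiplier_sets := [set A : set T | measurable A /\ multiplier \1_A].

Lemma sigma_algebra_multiplier_sets : sigma_algebra setT multiplier_sets.
Proof.
have mC A : multiplier_sets A -> multiplier_sets (~` A).
  move=> [mA hA]; split; first exact: measurableC.
  have -> : \1_(~` A) = (fun x => 1 - \1_A x) :> (T -> R).
    by apply/funext => x; rewrite !indicE in_setC; case: (x \in A); rewrite ?subrr ?subr0.
  exact: multiplierC.
split.
- split => //; rewrite indic0; exact: multiplier_cst.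
- by move=> A; rewrite setTD; exact: mC.
move=> F hF; split; first by apply: bigcupT_measurable => k; exact: (hF k).1.
(* This is the indicator of the union of the first [n] sets, written as a polynomial in their
   indicators; it converges to that of the whole union. *)
pose q n x := 1 - \prod_(i < n) (1 - \1_(F i) x) : R.
have prod01 n x : \prod_(i < n) (1 - \1_(F i) x) = (~~ [exists i : 'I_n, x \in F i])%:R :> R.
  have [/existsP[i xi]|/existsPn h] /= := boolP [exists i : 'I_n, x \in F i].
    by rewrite (bigD1 i)//= indicE xi subrr mul0r.
  by rewrite big1// => i _; rewrite indicE (negbTE (h i)) subr0.
apply: (@multiplier_lim q _ 1).
- move=> n; apply: multiplierC; elim: n => [|n IH].
    under eq_fun do rewrite big_ord0; exact: multiplier_cst.
  under eq_fun do rewrite big_ord_recr.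
  by apply: multiplierM => //; apply: multiplierC; exact: (hF n).2.
- by move=> n x; rewrite /q prod01; case: [exists _, _]; rewrite ?subr0 ?subrr ?normr0 ?normr1.
move=> x; rewrite indicE; have [[k _ Fkx]|nF] := pselect ((\bigcup_i F i) x).
  rewrite mem_set; last by exists k.
  apply: (@cvg_near_cst _ _ (1 : R)).
  exists k.+1 => // n /= kn; rewrite /q prod01.
  have -> : [exists i : 'I_n, x \in F i] by apply/existsP; exists (Ordinal kn); rewrite inE.
  by rewrite subr0.
rewrite memNset//; apply: (@cvg_near_cst _ _ (0 : R)); apply: nearW => n.
rewrite /q prod01; have -> : [exists i : 'I_n, x \in F i] = false.
  by apply/negbTE/existsPn => i; apply/negP; rewrite inE => h; apply: nF; exists i.
by rewrite subrr.
Qed.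

(** Testing on the set where [w >= 0] and on its complement shows that [|w|] has integral 0. *)
Lemma ae_eq0_of_set_integrals w : mu.-integrable setT (EFin \o w) ->
  (forall A, measurable A -> \int[mu]_x (\1_A x * w x) = 0) ->
  \forall x \ae mu, w x = 0.
Proof.
move=> iw h; have mw : measurable_fun setT w.
  exact/measurable_EFinP/(measurable_int _ iw).
pose A := [set x | 0 <= w x].
have mA : measurable A.
  rewrite /A -[X in measurable X]setTI.
  have -> : [set x | 0 <= w x] = w @^-1` `[0, +oo[.
    by apply/seteqP; split => x /=; rewrite in_itv /= andbT.
  by apply: mw => //; exact: measurable_itv.
have i1 B : measurable B -> mu.-integrable setT (EFin \o (fun x => \1_B x * w x)).
  move=> mB; apply: (le_integrable measurableT _ _ iw).
    by apply/measurable_EFinP; apply: measurable_funM => //; exact: measurable_indic.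
  move=> x _; rewrite /= lee_fin normrM indicE; case: (x \in B).
    by rewrite normr1 mul1r.
  by rewrite normr0 mul0r.
have E x : `|w x| = \1_A x * w x - \1_(~` A) x * w x.
  rewrite !indicE in_setC; have [wx|wx] := leP 0 (w x).
    by rewrite mem_set//= mul1r mul0r subr0 ger0_norm.
  rewrite memNset /A /= ?mul1r ?mul0r ?sub0r ?ltr0_norm//.
  by apply/negP; rewrite -ltNge.
have : \int[mu]_x `|w x| = 0.
  under eq_Rintegral do rewrite E.
  by rewrite RintegralB ?h ?subrr//; [exact: measurableC|exact: i1|apply: i1; exact: measurableC].
rewrite /Rintegral => e.
have : (\int[mu]_x `|(w x)%:E| = 0)%E.
  rewrite -[LHS]fineK ?e//; apply: integrable_fin_num => //.
  exact: integrable_norm.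
move=> /ae_eq_integral_abs []//; first exact/measurable_EFinP.
move=> N [mN N0 sub]; exists N; split => // x nx; apply: sub => /= k.
by apply: nx; case: (k Logic.I).
Qed.

End Multipliers.

Section MultiplierCriterion.
Context d (T : measurableType d) (R : realType).
Variable mu : {finite_measure set T -> \bar R}.
Variable W : set (T -> R).
Hypothesis iW : forall w, W w -> mu.-integrable setT (EFin \o w).

(** Under the integral the factor [X] can be moved from [p] to [w]; when [X w] is a combination of
    members of [W], a function [p] that kills [W] kills [X w] too. *)
Lemma multiplier_of_span (X : T -> R) : bounded_meas X ->
  (forall w, W w -> exists a b w1 w2,
    [/\ W w1, W w2 & forall x, X x * w x = a * w1 x + b * w2 x]) ->
  multiplier mu W X.
Proof.
move=> bX hX; split => // p [bp p0]; split=> [|w Ww]; first exact: bounded_measM.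
have [a [b [w1 [w2 [W1 W2 E]]]]] := hX _ Ww.
have i1 := integrable_bounded_meas iW bp W1.
have i2 := integrable_bounded_meas iW bp W2.
transitivity (\int[mu]_x (a * (p x * w1 x) + b * (p x * w2 x))).
  apply: eq_Rintegral => x _; rewrite (mulrC (X x)) -mulrA E; ring.
rewrite RintegralD//; last 2 first.
- exact: (integrableZl measurableT a i1).
- exact: (integrableZl measurableT b i2).
by rewrite !RintegralZl// !p0// !mulr0 addr0.
Qed.

End MultiplierCriterion.

(** * The spaces L^2 and L^oo of the circle *)

Section SquaredModulus.
Variable R : realType.
Implicit Types z w : R[i].

(** The squared modulus as a real polynomial in the coordinates, which keeps the square root of
    [normc] out of measurability proofs and inequalities. *)
Definition nsq z : R := Re z ^+ 2 + Im z ^+ 2.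

Lemma nsq_ge0 z : 0 <= nsq z. Proof. by rewrite addr_ge0// sqr_ge0. Qed.

Lemma normc_sqr z : normc z ^+ 2 = nsq z.
Proof. by case: z => a b; rewrite /= sqr_sqrtr// addr_ge0// sqr_ge0. Qed.

(** The generic conjugation and that of [R[i]] are convertible, and the latter reduces on pairs
    [x +i* y]. *)
Lemma conjCE z : z^* = (z^*)%C. Proof. by []. Qed.

Lemma nsqM z w : nsq (z * w) = nsq z * nsq w.
Proof. by case: z => a b; case: w => c e; rewrite /nsq /=; ring. Qed.

Lemma nsqJ z : nsq z^* = nsq z.
Proof. by rewrite conjCE; case: z => a b; rewrite /nsq /= sqrrN. Qed.

Lemma nsqN z : nsq (- z) = nsq z.
Proof. by case: z => a b; rewrite /nsq /= !sqrrN. Qed.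

Lemma nsqD_le z w : nsq (z + w) <= 2 * (nsq z + nsq w).
Proof.
case: z => a b; case: w => c e; rewrite /nsq /=.
have := sqr_ge0 (a - c); have := sqr_ge0 (b - e); nra.
Qed.

Lemma nsq_eq0 z : nsq z = 0 -> z = 0.
Proof.
case: z => a b /eqP; rewrite /nsq /= paddr_eq0 ?sqr_ge0// !sqrf_eq0.
by move=> /andP[/eqP-> /eqP->].
Qed.

Lemma normr_ReMJ z w : `|Re (z * w^*)| <= nsq z + nsq w.
Proof.
rewrite conjCE; case: z => a b; case: w => c e; rewrite /nsq /= ler_norml; apply/andP; split.
  have := sqr_ge0 (a + c); have := sqr_ge0 (b + e);
  have := sqr_ge0 (a - c); have := sqr_ge0 (b - e); nra.
have := sqr_ge0 (a + c); have := sqr_ge0 (b + e);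
have := sqr_ge0 (a - c); have := sqr_ge0 (b - e); nra.
Qed.

Lemma ImMJ z w : Im (z * w^*) = Re (z * ('i%C * w)^*).
Proof. by rewrite !conjCE; case: z => a b; case: w => c e /=; ring. Qed.

Lemma normr_ImMJ z w : `|Im (z * w^*)| <= nsq z + nsq w.
Proof.
rewrite ImMJ; apply: le_trans (normr_ReMJ _ _) _.
by rewrite nsqM [nsq 'i%C]/nsq /= expr0n expr1n add0r mul1r.
Qed.

Lemma conjCM z w : (z * w)^* = z^* * w^*. Proof. exact: rmorphM. Qed.

Lemma conjCKK z : z^*^* = z. Proof. exact: conjcK. Qed.

Lemma conjCD z w : (z + w)^* = z^* + w^*. Proof. exact: rmorphD. Qed.

Lemma complex_eq z w : Re z = Re w -> Im z = Im w -> z = w.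
Proof. by case: z => a b; case: w => c e /= -> ->. Qed.

End SquaredModulus.

(** * Complex-valued integrals and the inner product of L^2 *)

Section ComplexIntegral.
Variable R : realType.
Local Notation S1 := (circle R).
Local Notation mu := (@circle_measure R).
Implicit Types (f g h a : S1 -> R[i]) (c : R[i]).

Definition cmeas f := measurable_fun [set: S1] (fun z => Re (f z) : R) /\
  measurable_fun [set: S1] (fun z => Im (f z) : R).

Definition cintegrable f := mu.-integrable setT (fun z => (Re (f z))%:E) /\
  mu.-integrable setT (fun z => (Im (f z))%:E).

Lemma cmeas_cst c : cmeas (fun=> c).
Proof. by split; exact: measurable_cst. Qed.

Lemma cmeasD f g : cmeas f -> cmeas g -> cmeas (fun z => f z + g z).
Proof.
move=> [f1 f2] [g1 g2]; split.
  have -> : (fun z => Re (f z + g z)) = (fun z => Re (f z) + Re (g z) : R).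
    by apply/funext => z; case: (f z); case: (g z).
  exact: measurable_funD.
have -> : (fun z => Im (f z + g z)) = (fun z => Im (f z) + Im (g z) : R).
  by apply/funext => z; case: (f z); case: (g z).
exact: measurable_funD.
Qed.

Lemma cmeasM f g : cmeas f -> cmeas g -> cmeas (fun z => f z * g z).
Proof.
move=> [f1 f2] [g1 g2]; split.
  have -> : (fun z => Re (f z * g z)) =
      (fun z => Re (f z) * Re (g z) - Im (f z) * Im (g z) : R).
    by apply/funext => z; case: (f z); case: (g z).
  by apply: measurable_funB; apply: measurable_funM.
have -> : (fun z => Im (f z * g z)) =
    (fun z => Re (f z) * Im (g z) + Im (f z) * Re (g z) : R).
  by apply/funext => z; case: (f z) => ? ?; case: (g z).
by apply: measurable_funD; apply: measurable_funM.
Qed.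

Lemma cmeasJ f : cmeas f -> cmeas (fun z => (f z)^*).
Proof.
move=> [f1 f2]; split.
  have -> : (fun z => Re (f z)^*) = (fun z => Re (f z)).
    by apply/funext => z; case: (f z).
  exact: f1.
have -> : (fun z => Im (f z)^*) = (fun z => - Im (f z)).
  by apply/funext => z; case: (f z).
exact: measurableT_comp.
Qed.

Lemma cmeasN f : cmeas f -> cmeas (fun z => - f z).
Proof.
move=> mf; under eq_fun do rewrite -mulN1r.
by apply: cmeasM => //; exact: cmeas_cst.
Qed.

Lemma measurable_nsq f : cmeas f -> measurable_fun [set: S1] (fun z => nsq (f z)).
Proof. by move=> [f1 f2]; apply: measurable_funD; apply: measurable_funX. Qed.

Lemma aeqP f g : f = g %[ae mu] <-> \forall z \ae mu, f z = g z.
Proof. by split; apply: filterS => z; [exact|]. Qed.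

Lemma cintD f g : cintegrable f -> cintegrable g ->
  circle_integral (fun z => f z + g z) = circle_integral f + circle_integral g.
Proof.
move=> [f1 f2] [g1 g2]; rewrite /circle_integral.
have -> : (fun z => Re (f z + g z)) = (fun z => Re (f z) + Re (g z) : R).
  by apply/funext => z; case: (f z); case: (g z).
have -> : (fun z => Im (f z + g z)) = (fun z => Im (f z) + Im (g z) : R).
  by apply/funext => z; case: (f z); case: (g z).
by rewrite !RintegralD.
Qed.

Lemma cintZ c f : cintegrable f ->
  circle_integral (fun z => c * f z) = c * circle_integral f.
Proof.
case: c => a b [f1 f2]; rewrite /circle_integral.
have -> : (fun z => Re ((a +i* b)%C * f z)) = (fun z => a * Re (f z) - b * Im (f z) : R).
  by apply/funext => z; case: (f z).
have -> : (fun z => Im ((a +i* b)%C * f z)) = (fun z => a * Im (f z) + b * Re (f z) : R).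
  by apply/funext => z; case: (f z).
have i1 (r : R) : mu.-integrable setT (EFin \o (fun z => r * Re (f z))).
  exact: (integrableZl measurableT r f1).
have i2 (r : R) : mu.-integrable setT (EFin \o (fun z => r * Im (f z))).
  exact: (integrableZl measurableT r f2).
by rewrite RintegralB// RintegralD// !RintegralZl.
Qed.

Lemma cintJ f : cintegrable f ->
  circle_integral (fun z => (f z)^*) = (circle_integral f)^*.
Proof.
move=> [f1 f2]; rewrite /circle_integral.
have -> : (fun z => Re (f z)^*) = (fun z => Re (f z)).
  by apply/funext => z; case: (f z).
have -> : (fun z => Im (f z)^*) = (fun z => -1 * Im (f z)).
  by apply/funext => z; rewrite conjCE; case: (f z) => ? ? /=; rewrite mulN1r.
by rewrite RintegralZl//= mulN1r.
Qed.

Lemma cint_ae f g : cmeas f -> cmeas g -> (\forall z \ae mu, f z = g z) ->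
  circle_integral f = circle_integral g.
Proof.
move=> [f1 f2] [g1 g2] fg; congr Complex; rewrite /Rintegral; congr fine.
  apply: ae_eq_integral => //; [exact/measurable_EFinP|exact/measurable_EFinP|].
  by apply: filterS fg => z ->.
apply: ae_eq_integral => //; [exact/measurable_EFinP|exact/measurable_EFinP|].
by apply: filterS fg => z ->.
Qed.

Lemma L2P f : L2 f <-> cmeas f /\ mu.-integrable setT (fun z => (nsq (f z))%:E).
Proof.
have E : (\int[mu]_z `|(normc (f z))%:E| `^ 2 = \int[mu]_z (nsq (f z))%:E)%E.
  apply: eq_integral => z _.
  rewrite abse_EFin poweR_EFin powR_mulrn// ?normr_ge0//.
  by rewrite real_normK ?num_real// normc_sqr.
have E' : (\int[mu]_z `|(nsq (f z))%:E| = \int[mu]_z (nsq (f z))%:E)%E.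
  by apply: eq_integral => z _; rewrite gee0_abs// lee_fin nsq_ge0.
split=> [[f1 f2 /(poweR_lty 2)]|[[f1 f2] /integrableP[_]]].
  rewrite poweR_Lnorm//= E => fo; split => //.
  apply/integrableP; split; first exact/measurable_EFinP/measurable_nsq.
  by rewrite E'.
rewrite E' -E => fo; split => //; rewrite /finite_norm.
by apply: (@lty_poweRy _ _ 2) => //; rewrite poweR_Lnorm.
Qed.

Lemma LooP f : Loo f <->
  cmeas f /\ exists2 M, 0 <= M & \forall z \ae mu, nsq (f z) <= M.
Proof.
(* The norm of exponent [+oo] is defined as the essential supremum only when the whole space has
   positive measure. *)
have mu1 : (0 < mu [set: S1])%E by rewrite probability_setT lte01.
rewrite /Loo /Lcircle /= /finite_norm unlock mu1.
split=> [[f1 f2 /ess_sup_inf.ess_supr_bounded[M HM]]|[[f1 f2] [M M0 HM]]].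
  split => //; exists (M ^+ 2); first exact: sqr_ge0.
  apply: filterS HM => z /= h.
  rewrite -normc_sqr -real_normK ?num_real// ler_pXn2r ?nnegrE//.
  exact: le_trans h.
split => //; apply: (@le_lt_trans _ _ (Num.sqrt M)%:E); last exact: ltry.
apply/ess_sup_inf.ess_supP; apply: filterS HM => z h /=.
have n0 : 0 <= normc (f z) by case: (f z) => a b; exact: sqrtr_ge0.
rewrite lee_fin ger0_norm// -(@ler_pXn2r _ 2) ?nnegrE ?sqrtr_ge0//.
by rewrite normc_sqr sqr_sqrtr.
Qed.

Lemma L2_le f (g : S1 -> R) : cmeas f -> mu.-integrable setT (EFin \o g) ->
  (\forall z \ae mu, nsq (f z) <= g z) -> L2 f.
Proof.
move=> mf ig fg; apply/L2P; split => //; apply/integrableP; split.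
  exact/measurable_EFinP/measurable_nsq.
case/integrableP: (ig) => mg; apply: le_lt_trans.
apply: ae_ge0_le_integral => //.
- by apply: measurableT_comp => //; exact/measurable_EFinP/measurable_nsq.
- exact: measurableT_comp.
apply: filterS fg => z h _; rewrite !abse_EFin lee_fin ger0_norm ?nsq_ge0//.
exact: le_trans h (ler_norm _).
Qed.

Lemma L2_ae f g : cmeas g -> (\forall z \ae mu, g z = f z) -> L2 f -> L2 g.
Proof.
move=> mg gf /L2P[_ i]; apply: (L2_le mg i).
by apply: filterS gf => z ->.
Qed.

Lemma L2D f g : L2 f -> L2 g -> L2 (fun z => f z + g z).
Proof.
move=> /L2P[mf i] /L2P[mg j].
apply: (@L2_le _ (fun z => 2 * (nsq (f z) + nsq (g z)))).
- exact: cmeasD.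
- by apply: (integrableZl measurableT _ (integrableD measurableT i j)).
- by apply: nearW => z; exact: nsqD_le.
Qed.

Lemma L2_Loo a f : Loo a -> L2 f -> L2 (fun z => a z * f z).
Proof.
move=> /LooP[ma [M M0 HM]] /L2P[mf i].
apply: (@L2_le _ (fun z => M * nsq (f z))).
- exact: cmeasM.
- by apply: (integrableZl measurableT _ i).
- by apply: filterS HM => z h; rewrite nsqM ler_wpM2r// nsq_ge0.
Qed.

Lemma LooM a f : Loo a -> Loo f -> Loo (fun z => a z * f z).
Proof.
move=> /LooP[ma [M M0 HM]] /LooP[mf [K K0 HK]]; apply/LooP; split.
  exact: cmeasM.
exists (M * K); first exact: mulr_ge0.
by apply: filterS2 HM HK => z h k; rewrite nsqM ler_pM// nsq_ge0.
Qed.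

Lemma Loo_cst c : Loo (fun=> c).
Proof.
apply/LooP; split; first exact: cmeas_cst.
by exists (nsq c); [exact: nsq_ge0|exact: nearW].
Qed.

Lemma LooJ a : Loo a -> Loo (fun z => (a z)^*).
Proof.
move=> /LooP[ma [M M0 HM]]; apply/LooP; split; first exact: cmeasJ.
by exists M => //; apply: filterS HM => z; rewrite nsqJ.
Qed.

Lemma LooL2 a : Loo a -> L2 a.
Proof.
move=> /LooP[ma [M M0 HM]]; apply: (@L2_le _ (cst M)) => //.
exact: finite_measure_integrable_cst.
Qed.

Lemma L2Z c f : L2 f -> L2 (fun z => c * f z).
Proof. by move=> Lf; apply: L2_Loo => //; exact: Loo_cst. Qed.

Lemma L2N f : L2 f -> L2 (fun z => - f z).
Proof. by move=> Lf; under eq_fun do rewrite -mulN1r; exact: L2Z. Qed.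

Lemma L2B f g : L2 f -> L2 g -> L2 (fun z => f z - g z).
Proof. by move=> Lf Lg; apply: L2D => //; exact: L2N. Qed.

Lemma L2J f : L2 f -> L2 (fun z => (f z)^*).
Proof.
move=> /L2P[mf i]; apply/L2P; split; first exact: cmeasJ.
by under eq_fun do rewrite nsqJ.
Qed.

Lemma L2_cmeas f : L2 f -> cmeas f. Proof. by move=> /L2P[]. Qed.
Lemma Loo_cmeas f : Loo f -> cmeas f. Proof. by move=> /LooP[]. Qed.

Lemma cintegrable_inner f g : L2 f -> L2 g -> cintegrable (fun z => f z * (g z)^*).
Proof.
move=> /L2P[mf i] /L2P[mg j].
have [m1 m2] := cmeasM mf (cmeasJ mg).
split.
  apply: (le_integrable _ _ _ (integrableD measurableT i j)) => //; first exact/measurable_EFinP.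
  move=> z _; rewrite !abse_EFin lee_fin.
  by apply: le_trans (normr_ReMJ _ _) _; exact: ler_norm.
apply: (le_integrable _ _ _ (integrableD measurableT i j)) => //; first exact/measurable_EFinP.
move=> z _; rewrite !abse_EFin lee_fin.
by apply: le_trans (normr_ImMJ _ _) _; exact: ler_norm.
Qed.

Lemma innerDl f g h : L2 f -> L2 g -> L2 h ->
  inner (fun z => f z + g z) h = inner f h + inner g h.
Proof.
move=> Lf Lg Lh; rewrite /inner -cintD; try exact: cintegrable_inner.
by congr circle_integral; apply/funext => z; rewrite mulrDl.
Qed.

Lemma innerZl c f g : L2 f -> L2 g ->
  inner (fun z => c * f z) g = c * inner f g.
Proof.
move=> Lf Lg; rewrite /inner -cintZ; last exact: cintegrable_inner.
by congr circle_integral; apply/funext => z; rewrite mulrA.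
Qed.

Lemma innerC f g : L2 f -> L2 g -> inner g f = (inner f g)^*.
Proof.
move=> Lf Lg; rewrite /inner -cintJ; last exact: cintegrable_inner.
by congr circle_integral; apply/funext => z; rewrite conjCM conjCKK mulrC.
Qed.

Lemma innerBl f g h : L2 f -> L2 g -> L2 h ->
  inner (fun z => f z - g z) h = inner f h - inner g h.
Proof.
move=> Lf Lg Lh; rewrite innerDl//; last exact: L2N.
have -> : (fun z => - g z) = (fun z => -1 * g z).
  by apply/funext => z; rewrite mulN1r.
by rewrite innerZl// mulN1r.
Qed.

Lemma innerDr f g h : L2 f -> L2 g -> L2 h ->
  inner h (fun z => f z + g z) = inner h f + inner h g.
Proof.
move=> Lf Lg Lh; rewrite innerC ?innerDl//; last exact: L2D.
by rewrite conjCD (innerC Lf Lh) (innerC Lg Lh).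
Qed.

Lemma innerZr c f g : L2 f -> L2 g ->
  inner g (fun z => c * f z) = c^* * inner g f.
Proof.
move=> Lf Lg; rewrite innerC ?innerZl//; last exact: L2Z.
by rewrite conjCM (innerC Lf Lg).
Qed.

Lemma inner_ae f f' g g' : cmeas f -> cmeas f' -> cmeas g -> cmeas g' ->
  (\forall z \ae mu, f z = f' z) -> (\forall z \ae mu, g z = g' z) ->
  inner f g = inner f' g'.
Proof.
move=> mf mf' mg mg' ff' gg'; apply: cint_ae.
- by apply: cmeasM => //; exact: cmeasJ.
- by apply: cmeasM => //; exact: cmeasJ.
- by apply: filterS2 ff' gg' => z -> ->.
Qed.

Lemma inner_adj a f g : inner (fun z => a z * f z) g = inner f (fun z => (a z)^* * g z).
Proof.
congr circle_integral; apply/funext => z; by rewrite conjCM conjCKK mulrCA mulrA.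
Qed.

Definition sqn f : R := Re (inner f f).

Lemma sqnE f : L2 f -> (sqn f)%:E = (\int[mu]_z (nsq (f z))%:E)%E.
Proof.
move=> /L2P[mf i]; rewrite /sqn /inner /= /Rintegral fineK; last first.
  rewrite (_ : (fun z => _) = (fun z => (nsq (f z))%:E)); last first.
    apply/funext => z; congr EFin.
    by rewrite conjCE; case: (f z) => x y; rewrite /nsq /=; ring.
  exact: integrable_fin_num.
apply: eq_integral => z _; congr EFin.
by rewrite conjCE; case: (f z) => x y; rewrite /nsq /=; ring.
Qed.

Lemma sqn_ge0 f : L2 f -> 0 <= sqn f.
Proof.
move=> Lf; rewrite -lee_fin sqnE//; apply: integral_ge0 => z _.
by rewrite lee_fin nsq_ge0.
Qed.

Lemma sqn_eq0 f : L2 f -> sqn f = 0 -> \forall z \ae mu, f z = 0.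
Proof.
move=> Lf f0; have /L2P[mf i] := Lf.
have : (\int[mu]_z `|(nsq (f z))%:E| = 0)%E.
  transitivity (sqn f)%:E; last by rewrite f0.
  rewrite sqnE//; apply: eq_integral => z _.
  by rewrite gee0_abs// lee_fin nsq_ge0.
move=> /ae_eq_integral_abs []//; first exact/measurable_EFinP/measurable_nsq.
move=> N [mN N0 sub]; exists N; split => // z nz; apply: sub => /= h.
by apply: nz; apply: nsq_eq0; case: (h Logic.I).
Qed.

End ComplexIntegral.

(** * Orthogonal projections *)

Section HilbertProjection.
Variable R : realType.
Local Notation S1 := (circle R).
Local Notation mu := (@circle_measure R).
Implicit Types (f g h : S1 -> R[i]) (c : R[i]).

(** The limit arguments of the projection theorem are phrased as geometric error bounds, and this
    lemma concludes them. *)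
Lemma le0_geometric (x C : R) : (forall n, x <= C * 2 ^- n) -> x <= 0.
Proof.
move=> h; have : (fun n => C * 2^-1 ^+ n) @ \oo --> C * 0.
  apply: cvgM; first exact: cvg_cst.
  by apply: cvg_expr; rewrite ger0_norm ?invr_ge0// invf_lt1// ltr1n.
rewrite mulr0 => c; rewrite -(cvg_lim _ c)//; apply: limr_ge.
  by apply/cvg_ex; eexists; exact: c.
by apply: nearW => n; rewrite exprVn.
Qed.

Lemma inner0l f : inner (fun=> 0) f = 0.
Proof.
rewrite /inner /circle_integral; under eq_Rintegral do rewrite mul0r.
under [X in (_ +i* X)%C]eq_Rintegral do rewrite mul0r.
by rewrite /Rintegral /= integral0.
Qed.

Lemma sqnD f g : L2 f -> L2 g ->
  sqn (fun z => f z + g z) = sqn f + 2 * Re (inner f g) + sqn g.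
Proof.
move=> Lf Lg; rewrite /sqn innerDl ?innerDr//; last exact: L2D.
rewrite (innerC Lf Lg) conjCE.
by case: (inner f f) => ? ?; case: (inner f g) => ? ?; case: (inner g g) => ? ? /=; ring.
Qed.

Lemma sqnZ c f : L2 f -> sqn (fun z => c * f z) = nsq c * sqn f.
Proof.
move=> Lf; rewrite /sqn innerZl ?innerZr//; last exact: L2Z.
by rewrite conjCE /nsq; case: (inner f f) => x y; case: c => a b /=; ring.
Qed.

(* For [d = 0] and [eps = sqn f] this is the Cauchy-Schwarz inequality, with a
   harmless [+ 1] that spares the case [sqn g = 0]. *)
Lemma inner_le_of_minimal f g (d eps : R) : L2 f -> L2 g ->
  (forall c, d <= sqn (fun z => f z + c * g z)) -> sqn f <= d + eps ->
  nsq (inner f g) <= (sqn g + 1) * eps.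
Proof.
move=> Lf Lg hd he; set s := inner f g.
have G0 := sqn_ge0 Lg; set G := sqn g + 1.
have Gp : 0 < G by rewrite ltr_wpDl.
(* The minimizer of the quadratic in [c] would be [- s / sqn g]; replacing [sqn g] by [G] avoids the
   division by zero and still decreases it enough. *)
have := hd (- (s * (G^-1)%:C)%C); rewrite sqnD ?sqnZ//; last exact: L2Z.
rewrite innerZr// -/s; set K := nsq s.
have -> : nsq (- (s * (G^-1)%:C)%C) = K * (G^-1) ^+ 2.
  by rewrite nsqN nsqM [nsq (G^-1)%:C%C]/nsq /= expr0n addr0.
have -> : Re ((- (s * (G^-1)%:C)%C)^* * s) = - (K * G^-1).
  by rewrite conjCE /K /nsq; case: (s) => x y /=; ring.
move=> h; have K0 : 0 <= K by exact: nsq_ge0.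
have Gi : 0 < G^-1 by rewrite invr_gt0.
have E : K * G^-1 ^+ 2 * sqn g <= K * G^-1.
  rewrite -mulrA ler_wpM2l// expr2 -mulrA ler_piMr ?(ltW Gi)//.
  by rewrite ler_pdivrMl// mulr1 /G lerDl.
rewrite mulrC -ler_pdivrMr//; nra.
Qed.

Lemma inner_le f g : L2 f -> L2 g -> nsq (inner f g) <= (sqn g + 1) * sqn f.
Proof.
move=> Lf Lg; apply: (@inner_le_of_minimal _ _ 0) => //; last by rewrite add0r.
by move=> c; apply: sqn_ge0; apply: L2D => //; exact: L2Z.
Qed.

(** The real and imaginary parts converge separately, each with error [4 * 2 ^- n]; their sum gives
    the constant 8. *)
Lemma L2_complete (f : nat -> S1 -> R[i]) : (forall n, L2 (f n)) ->
  (forall n, sqn (fun z => f n.+1 z - f n z) <= 4 ^- n) ->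
  exists2 g, L2 g & forall n, sqn (fun z => g z - f n z) <= 8 * 2 ^- n.
Proof.
move=> Lf hf.
have mf n : cmeas (f n) by exact: L2_cmeas.
have mD n : cmeas (fun z => f n.+1 z - f n z).
  by apply: cmeasD => //; exact: cmeasN.
have key n : (\int[mu]_z (nsq (f n.+1 z - f n z))%:E <= (4 ^- n)%:E)%E.
  by rewrite -sqnE ?lee_fin//; exact: L2B.
have ReB (x y : R[i]) : Re (x - y) = Re x - Re y by case: x; case: y.
have ImB (x y : R[i]) : Im (x - y) = Im x - Im y by case: x; case: y.
have [|n|u mu_ hu] := @riesz_fischer _ _ _ mu (fun n z => Re (f n z)).
- by move=> n; exact: (mf n).1.
- apply: le_trans (key n); apply: ge0_le_integral => //.
  + by move=> z _; rewrite lee_fin sqr_ge0.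
  + apply/measurable_EFinP; apply: measurable_funX.
    by apply: measurable_funB; [exact: (mf n.+1).1|exact: (mf n).1].
  + exact/measurable_EFinP/measurable_nsq.
  + by move=> z _; rewrite lee_fin /nsq ReB lerDl sqr_ge0.
have [|n|v mv hv] := @riesz_fischer _ _ _ mu (fun n z => Im (f n z)).
- by move=> n; exact: (mf n).2.
- apply: le_trans (key n); apply: ge0_le_integral => //.
  + by move=> z _; rewrite lee_fin sqr_ge0.
  + apply/measurable_EFinP; apply: measurable_funX.
    by apply: measurable_funB; [exact: (mf n.+1).2|exact: (mf n).2].
  + exact/measurable_EFinP/measurable_nsq.
  + by move=> z _; rewrite lee_fin /nsq ImB lerDr sqr_ge0.
pose g z := (u z +i* v z)%C.
have mg : cmeas g by [].
have mgf n : cmeas (fun z => g z - f n z) by apply: cmeasD => //; exact: cmeasN.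
have bnd n : (\int[mu]_z (nsq (g z - f n z))%:E <= (8 * 2 ^- n)%:E)%E.
  rewrite (_ : 8 * 2 ^- n = 4 * 2 ^- n + 4 * 2 ^- n) ?EFinD; last by ring.
  apply: le_trans (leeD (hu n) (hv n)).
  rewrite -ge0_integralD//; last 4 first.
  - by move=> z _; rewrite lee_fin sqr_ge0.
  - apply/measurable_EFinP; apply: measurable_funX; apply: measurable_funB => //.
    exact: (mf n).1.
  - by move=> z _; rewrite lee_fin sqr_ge0.
  - apply/measurable_EFinP; apply: measurable_funX; apply: measurable_funB => //.
    exact: (mf n).2.
  rewrite le_eqVlt; apply/orP; left; apply/eqP; apply: eq_integral => z _.
  by rewrite /nsq ReB ImB EFinD.
have Lgf n : L2 (fun z => g z - f n z).
  apply/L2P; split => //; apply/integrableP; split.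
    exact/measurable_EFinP/measurable_nsq.
  under eq_integral do rewrite gee0_abs ?lee_fin ?nsq_ge0//.
  by apply: le_lt_trans (bnd n) _; exact: ltry.
exists g; last by move=> n; rewrite -lee_fin sqnE.
have := L2D (Lgf 0%N) (Lf 0%N); congr L2.
by apply/funext => z; rewrite subrK.
Qed.

(** Closed subspaces enter only as orthogonal complements: no topology on L^2 is needed, since
    [inner_le] shows directly that they contain their limits. *)
Definition perp (U : set (S1 -> R[i])) :=
  [set h | L2 h /\ forall u, U u -> inner h u = 0].

Lemma L2_cst0 : L2 (fun=> 0 : R[i]).
Proof. exact: LooL2 (Loo_cst 0). Qed.

Lemma perp_lin U c g h : U `<=` @L2 R -> perp U g -> perp U h ->
  perp U (fun z => h z + c * g z).
Proof.
move=> UL [Lg g0] [Lh h0]; split=> [|u Uu]; first by apply: L2D => //; exact: L2Z.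
have Lu := UL _ Uu.
by rewrite innerDl ?innerZl ?g0 ?h0 ?mulr0 ?addr0//; exact: L2Z.
Qed.

(** The classical argument: by the parallelogram law a minimizing sequence of the distance from [f]
    to [perp U] is Cauchy, and [f - h n] is orthogonal to [perp U] up to an error that tends to
    0. *)
Lemma hilbert_projection U f : U `<=` @L2 R -> L2 f ->
  exists2 h, perp U h & forall g, perp U g -> inner (fun z => f z - h z) g = 0.
Proof.
move=> UL Lf; pose D := [set sqn (fun z => f z - h z) | h in perp U].
have D0 : lbound D 0 by move=> _ [h [Lh _] <-]; apply: sqn_ge0; exact: L2B.
have hD : has_inf D.
  split; last by exists 0.
  exists (sqn (fun z => f z - 0)); exists (fun=> 0) => //.
  by split; [exact: L2_cst0|move=> u _; rewrite inner0l].
(* The parallelogram law will bound the squared distance of consecutive terms by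
   [2 * eps n + 2 * eps n.+1], which is below the [4 ^- n] required by [L2_complete]. *)
pose eps n : R := 4 ^- n / 8.
have eps0 n : 0 < eps n by rewrite divr_gt0// invr_gt0 exprn_gt0.
have /choice[h hh] : forall n, exists h : S1 -> R[i],
    perp U h /\ sqn (fun z => f z - h z) < inf D + eps n.
  by move=> n; have [_ [h Uh <-] hlt] := inf_adherent (eps0 n) hD; exists h.
have Uh n := (hh n).1; have Lh n := (Uh n).1.
have Dle g : perp U g -> inf D <= sqn (fun z => f z - g z).
  by move=> Ug; apply: ge_inf; [exists 0|exists g].
have [||k Lk hk] := @L2_complete h => //.
  move=> n; set a := (fun z => f z - h n z); set b := (fun z => f z - h n.+1 z).
  have La : L2 a by exact: L2B.
  have Lb : L2 b by exact: L2B.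
  have -> : (fun z => h n.+1 z - h n z) = (fun z => a z + (-1) * b z).
    by apply/funext => z; rewrite /a /b; ring.
  rewrite (sqnD La (L2Z (-1) Lb)) sqnZ ?innerZr//.
  (* The midpoint of [h n] and [h n.+1] also lies in [perp U], so its distance to [f] is bounded
     below by the infimum. *)
  have m := Dle _ (perp_lin (1 / 2) UL (perp_lin (-1) UL (Uh n) (Uh n.+1)) (Uh n)).
  have : inf D <= sqn (fun z => (1 / 2) * (a z + b z)).
    apply: le_trans m _; rewrite le_eqVlt; apply/orP; left; apply/eqP.
    by congr sqn; apply/funext => z; rewrite /a /b; field.
  rewrite sqnZ ?(sqnD La Lb)//; last exact: L2D.
  have -> : nsq (1 / 2 : R[i]) = 1 / 4.
    have : nsq (1 / 2 : R[i]) * nsq (2 : R[i]) = 1.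
      by rewrite -nsqM divfK ?pnatr_eq0// /nsq /= expr1n expr0n addr0.
    have -> : nsq (2 : R[i]) = 4 by rewrite /nsq /=; ring.
    lra.
  have -> : nsq (-1 : R[i]) = 1 by rewrite nsqN /nsq /= expr1n expr0n addr0.
  have -> : Re ((-1)^* * inner a b) = - Re (inner a b).
    by rewrite conjCE; case: (inner a b) => x y /=; ring.
  have := (hh n).2; have := (hh n.+1).2; rewrite -/a -/b.
  have -> : eps n.+1 = eps n / 4 by rewrite /eps exprS invfM; field; rewrite expf_neq0.
  have -> : 4 ^- n = 8 * eps n by rewrite /eps; field; rewrite expf_neq0.
  have := eps0 n; lra.
have Uk : perp U k.
  split => // u Uu; apply: nsq_eq0; apply/eqP; rewrite eq_le nsq_ge0 andbT.
  apply: (@le0_geometric _ ((sqn u + 1) * 8)) => n; rewrite -mulrA.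
  have Lu := UL _ Uu; have G0 := sqn_ge0 Lu.
  apply: (@le_trans _ _ ((sqn u + 1) * sqn (fun z => k z - h n z))).
    have <- : inner (fun z => k z - h n z) u = inner k u.
      by rewrite innerBl// (Uh n).2// subr0.
    by apply: inner_le => //; exact: L2B.
  by rewrite ler_wpM2l// addr_ge0.
exists k => // g Ug; have Lg := Ug.1; have G0 := sqn_ge0 Lg.
apply: nsq_eq0; apply/eqP; rewrite eq_le nsq_ge0 andbT.
(* Near minimality of [h n] contributes an error [eps n <= 2 ^- n] and the distance from [k] to
   [h n] an error [8 * 2 ^- n]; doubled by [nsqD_le], they total 18, which is below 20. *)
apply: (@le0_geometric _ ((sqn g + 1) * 20)) => n.
have -> : inner (fun z => f z - k z) g =
    inner (fun z => f z - h n z) g + - inner (fun z => k z - h n z) g.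
  by rewrite !innerBl//; ring.
apply: le_trans (nsqD_le _ _) _; rewrite nsqN.
have b1 : nsq (inner (fun z => f z - h n z) g) <= (sqn g + 1) * eps n.
  apply: (@inner_le_of_minimal _ _ (inf D)) => //; [exact: L2B| |exact: ltW (hh n).2].
  move=> c; apply: le_trans (Dle _ (perp_lin (- c) UL Ug (Uh n))) _.
  rewrite le_eqVlt; apply/orP; left; apply/eqP.
  by congr sqn; apply/funext => z; ring.
have b2 : nsq (inner (fun z => k z - h n z) g) <= (sqn g + 1) * (8 * 2 ^- n).
  apply: le_trans (inner_le _ Lg) _; first exact: L2B.
  by rewrite ler_wpM2l// addr_ge0.
have b3 : eps n <= 2 ^- n.
  rewrite /eps [4](_ : _ = 2 * 2); last by ring.
  have q0 : 0 <= 2 ^- n :> R by rewrite invr_ge0 exprn_ge0.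
  have q1 : 2 ^- n <= 1 :> R by rewrite invf_le1 ?exprn_gt0// exprn_ege1// ler1n.
  rewrite exprMn invfM; nra.
have b4 : (sqn g + 1) * eps n <= (sqn g + 1) * 2 ^- n by rewrite ler_wpM2l// addr_ge0.
have : 0 <= (sqn g + 1) * 2 ^- n by rewrite mulr_ge0 ?addr_ge0// invr_ge0 exprn_ge0.
move: b1 b2 b4; rewrite [_ * (8 * _)]mulrCA -[_ * 20 * _]mulrA [_ * (20 * _)]mulrCA; lra.
Qed.

End HilbertProjection.

(** * Characters of the circle *)

Section Characters.
Variable R : realType.
Local Notation S1 := (circle R).
Local Notation mu := (@circle_measure R).
Implicit Types (f g h : S1 -> R[i]) (c : R[i]) (z : S1).

Definition echar (n : int) : S1 -> R[i] := fun z => (z : R[i]) ^ n.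

Lemma nsq_circle z : nsq (z : R[i]) = 1.
Proof.
have /eqP := circle_valP z; rewrite normc_def => -[h].
by rewrite /nsq -[LHS]sqr_sqrtr ?addr_ge0 ?sqr_ge0// h expr1n.
Qed.

Lemma circle_Re_le1 z : `|Re (z : R[i])| <= 1.
Proof.
have := nsq_circle z; case: (z : R[i]) => x y; rewrite /nsq /= => h.
by rewrite ler_norml; have := sqr_ge0 y => y0; apply/andP; split; nra.
Qed.

Lemma circle_Im_le1 z : `|Im (z : R[i])| <= 1.
Proof.
have := nsq_circle z; case: (z : R[i]) => x y; rewrite /nsq /= => h.
by rewrite ler_norml; have := sqr_ge0 x => x0; apply/andP; split; nra.
Qed.

Lemma mul_conj_circle z : (z : R[i]) * (z : R[i])^* = 1.
Proof.
have := nsq_circle z; rewrite conjCE /nsq; case: (z : R[i]) => a b /= h.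
by apply: complex_eq => /=; rewrite -?h; ring.
Qed.

Lemma circle_neq0 z : (z : R[i]) != 0.
Proof.
by apply/eqP => z0; have := mul_conj_circle z; rewrite z0 mul0r => /esym/eqP; rewrite oner_eq0.
Qed.

Lemma circleJ z : (z : R[i])^* = (z : R[i])^-1.
Proof. by apply: (mulfI (circle_neq0 z)); rewrite mul_conj_circle divff// circle_neq0. Qed.

Lemma echarD m n z : echar (m + n) z = echar m z * echar n z.
Proof. by rewrite /echar expfzDr// circle_neq0. Qed.

Lemma echar0 z : echar 0 z = 1. Proof. by rewrite /echar expr0z. Qed.

Lemma echar1 z : echar 1 z = z. Proof. by rewrite /echar expr1z. Qed.

Lemma echarNJ n z : (echar n z)^* = echar (- n) z.
Proof.
have -> : (echar n z)^* = ((z : R[i])^*) ^ n.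
  by apply: rmorphXz; rewrite unitfE circle_neq0.
by rewrite circleJ exprz_inv.
Qed.

Lemma nsq_echar n z : nsq (echar n z) = 1.
Proof.
have h : echar n z * (echar n z)^* = 1 by rewrite echarNJ -echarD subrr echar0.
have : Re (echar n z * (echar n z)^*) = 1 by rewrite h.
by rewrite conjCE /nsq; case: (echar n z) => a b /= <-; ring.
Qed.

Lemma cmeas_echar n : cmeas (echar n).
Proof.
have mz : cmeas (fun z => z : R[i]).
  have mc : measurable_fun [set: S1] (@circle_coord R).
    by move=> _ B mB; exists B.
  by split; [exact: (measurableT_comp measurable_fst mc)
            |exact: (measurableT_comp measurable_snd mc)].
have mn (k : nat) : cmeas (echar k).
  elim: k => [|k IH].
    by rewrite (_ : echar _ = fun=> 1); [exact: cmeas_cst|apply/funext => z; rewrite echar0].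
  rewrite (_ : echar _ = fun z => (z : R[i]) * echar k z); first exact: cmeasM.
  by apply/funext => z; rewrite -echar1 -echarD.
have [|k|k] := intP n; [exact: (mn 0%N)|exact: mn|].
rewrite (_ : echar _ = fun z => (echar k.+1 z)^*); first exact: cmeasJ.
by apply/funext => z; rewrite echarNJ.
Qed.

Lemma Loo_echar n : Loo (echar n).
Proof.
apply/LooP; split; first exact: cmeas_echar.
by exists 1 => //; apply: nearW => z; rewrite nsq_echar.
Qed.

Lemma L2_echar n : L2 (echar n). Proof. exact: LooL2 (Loo_echar n). Qed.

Lemma fourierE f n : fourier f n = inner f (echar n).
Proof.
rewrite /fourier /inner; congr circle_integral; apply/funext => z.
by rewrite echarNJ.
Qed.

Lemma echar_exp (n : nat) (t : R) : echar n (circle_exp t) =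
  (cos (2 * pi * n%:R * t) +i* sin (2 * pi * n%:R * t))%C.
Proof.
elim: n => [|n IH]; first by rewrite mulr0 mul0r cos0 sin0 echar0.
rewrite -addn1 PoszD echarD IH echar1 natrD /=.
have -> : 2 * pi * (n%:R + 1) * t = 2 * pi * n%:R * t + 2 * pi * t by ring.
by rewrite cosD sinD; congr Complex; ring.
Qed.

Lemma cos_sin_2pin (n : nat) : cos (2 * pi * n%:R) = 1 :> R /\ sin (2 * pi * n%:R) = 0 :> R.
Proof.
have := echar_exp n 1; rewrite mulr1 => h.
have e1 : (circle_exp (1 : R) : R[i]) = 1.
  by rewrite /= mulr1 mulr_natl cos2pi sin2pi.
by move: h; rewrite /echar e1 exp1rz => -[<- <-].
Qed.

Lemma circle_integral_ge0 (p : S1 -> R) :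
  measurable_fun setT p -> (forall z, 0 <= p z) ->
  (\int[mu]_z (p z)%:E =
   \int[lebesgue_measure]_(t in `[0%R, 1%R]) (p (circle_exp t))%:E)%E.
Proof.
move=> mp p0.
rewrite /circle_measure ge0_integral_distribution//; last first.
  exact/measurable_EFinP.
rewrite integral_uniform//; last 2 first.
- by apply/measurable_EFinP; apply: (measurableT_comp mp); exact: measurable_circle_exp.
- by move=> t; rewrite lee_fin.
by rewrite subr0 invr1 mul1e.
Qed.

(* [integral_uniform] only covers nonnegative functions, hence the detour
   through [1 + p]. *)
Lemma integral_circle_periodic (p : S1 -> R) (F f : R -> R) :
  measurable_fun setT p -> (forall z, -1 <= p z) ->
  (forall t, p (circle_exp t) = f t) ->
  (forall t : R, is_derive t 1 F (f t)) -> F 1 = F 0 -> continuous f ->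
  \int[mu]_z p z = 0.
Proof.
move=> mp p1 pf dF F10 cf.
have h : (\int[mu]_z (1 + p z)%:E = 1)%E.
  rewrite circle_integral_ge0; last 2 first.
  - exact: measurable_funD.
  - by move=> z; rewrite -lerBlDl sub0r.
  under eq_integral do rewrite pf.
  have dG (t : R) : is_derive t 1 (fun t => t + F t) (1 + f t).
    by apply: is_deriveD.
  rewrite (@continuous_FTC2 _ _ (fun t => t + F t)) ?ltr01//.
  - by rewrite F10 -EFinB; congr EFin; ring.
  - apply: continuous_subspaceT => t; apply: cvgD; [exact: cvg_cst|exact: cf].
  - have cG (t : R) : {for t, continuous (fun t => t + F t)}.
      by apply/differentiable_continuous/derivable1_diffP; case: (dG t).
    split.
    + by move=> t _; case: (dG t).
    + exact/cvg_at_right_filter/cG.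
    + exact/cvg_at_left_filter/cG.
  - by move=> t _; rewrite derive1E; case: (dG t).
have ip : mu.-integrable setT (fun z => (1 + p z)%:E).
  apply/integrableP; split.
    by apply/measurable_EFinP; exact: measurable_funD.
  under eq_integral do rewrite gee0_abs ?lee_fin -?lerBlDl ?sub0r//.
  by rewrite h ltry.
have : \int[mu]_z ((1 + p z) - cst 1 z) = 0.
  rewrite RintegralB//; last exact: finite_measure_integrable_cst.
  rewrite {1}/Rintegral h Rintegral_cst//= probability_setT /=.
  by rewrite mulr1 subrr.
by move=> <-; apply: eq_Rintegral => z _ /=; rewrite addrC addKr.
Qed.

(** On [[0, 1]] the real and imaginary parts have the primitives [sin (a t) / a] and
    [- cos (a t) / a] with [a = 2 pi n], which agree at both ends. Negative indices follow by
    conjugation. *)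
Lemma integral_echar (n : int) : n != 0 -> circle_integral (echar n) = 0.
Proof.
have Re_le (w : R[i]) : nsq w = 1 -> -1 <= Re w /\ -1 <= Im w.
  case: w => a b; rewrite /nsq /= => h; split.
    have := sqr_ge0 b; nra.
  have := sqr_ge0 a; nra.
have pos (k : nat) : (0 < k)%N -> circle_integral (echar k) = 0.
  move=> k0; have [m1 m2] := cmeas_echar k.
  have a0 : 2 * pi * k%:R != 0 :> R.
    by rewrite !mulf_neq0// ?gt_eqF ?pi_gt0 ?ltr0n.
  set a := 2 * pi * k%:R in a0.
  have [c1 s1] := cos_sin_2pin k; rewrite -/a in c1 s1.
  have dl (t : R) : is_derive t 1 (fun t => a * t) a.
    by apply: is_derive_eq; rewrite /GRing.scale /= mulr1.
  congr Complex.
    apply: (@integral_circle_periodic _ (fun t => sin (a * t) / a) (fun t => cos (a * t))) => //.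
    + by move=> z; case: (Re_le _ (nsq_echar k z)).
    + by move=> t; rewrite echar_exp.
    + move=> t; apply: is_derive_eq; rewrite /GRing.scale /=; field; exact: a0.
    + by rewrite mulr1 mulr0 s1 sin0.
    + move=> t; apply: continuous_comp; last exact: continuous_cos.
      by apply: cvgM; [exact: cvg_cst|exact: cvg_id].
  apply: (@integral_circle_periodic _ (fun t => - cos (a * t) / a) (fun t => sin (a * t))) => //.
  + by move=> z; case: (Re_le _ (nsq_echar k z)).
  + by move=> t; rewrite echar_exp.
  + move=> t; apply: is_derive_eq; rewrite /GRing.scale /=; field; exact: a0.
  + by rewrite mulr1 mulr0 c1 cos0.
  + move=> t; apply: continuous_comp; last exact: continuous_sin.
    by apply: cvgM; [exact: cvg_cst|exact: cvg_id].
have [//|k _|k _] := intP n; first exact: pos.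
rewrite (_ : echar _ = fun z => (echar k.+1 z)^*); last first.
  by apply/funext => z; rewrite echarNJ.
have := cintegrable_inner (L2_echar k.+1) (L2_echar 0).
rewrite (_ : (fun z => _) = echar k.+1) => [i|]; last first.
  by apply/funext => z; rewrite echar0 rmorph1 mulr1.
by rewrite cintJ// pos// rmorph0.
Qed.

Lemma inner_echar (m n : int) : m != n -> inner (echar m) (echar n) = 0.
Proof.
move=> mn; rewrite /inner (_ : (fun z => _) = echar (m - n)).
  by rewrite integral_echar// subr_eq0.
by apply/funext => z; rewrite echarNJ -echarD.
Qed.

End Characters.

(** * The Hardy space *)

Section Hardy.
Variable R : realType.
Local Notation S1 := (circle R).
Local Notation mu := (@circle_measure R).
Implicit Types (f g h r u a b : S1 -> R[i]) (c : R[i]) (z : S1).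

(* The coordinates are measurable for the measurable structure whose measurable
   sets are those of [G]. *)
Lemma circle_measurable_sub (G : set (set S1)) : sigma_algebra setT G ->
  (forall x, G [set z | Re (z : R[i]) < x]) ->
  (forall x, G [set z | Im (z : R[i]) < x]) ->
  measurable `<=` G.
Proof.
move=> sG GX GY _ [B mB <-].
have ray (p : S1 -> R) : (forall x, G [set z | p z < x]) ->
    measurable_fun [set: g_sigma_algebraType G] (p : g_sigma_algebraType G -> R).
  move=> Gp mT; apply: (measurability _ (RGenInftyO.measurableE R)) => //.
  move=> _ [_ [x ->] <-]; apply: sub_sigma_algebra; rewrite setTI.
  rewrite (_ : _ @^-1` _ = [set z | p z < x]).
    exact: Gp.
  by apply/seteqP; split => z /=; rewrite in_itv.
have mc : measurable_fun [set: g_sigma_algebraType G]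
    (@circle_coord R : g_sigma_algebraType G -> R * R).
  by apply: (measurable_fun_pair (ray _ GX) (ray _ GY)).
have := mc measurableT B mB.
by apply: (@smallest_sub _ (sigma_algebra setT) G G sG).
Qed.

Theorem fourier_complete f : L2 f -> (forall n, fourier f n = 0) ->
  \forall z \ae mu, f z = 0.
Proof.
move=> Lf f0.
pose w n z := f z * (echar n z)^*.
(* Multipliers are real functions, so each Fourier coefficient contributes two members.
   Multiplication by [z] or its conjugate shifts [n] by one, hence [Re z] and [Im z] map [W] into
   its span. *)
pose W := [set v : S1 -> R | exists n, v = (fun z => Re (w n z)) \/ v = (fun z => Im (w n z))].
have iw n : cintegrable (w n) by apply: cintegrable_inner => //; exact: L2_echar.
have iW v : W v -> mu.-integrable setT (EFin \o v).
  by move=> [n [->|->]]; [exact: (iw n).1|exact: (iw n).2].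
have bX : bounded_meas (fun z : S1 => Re (z : R[i])).
  split; last by exists 1; exact: circle_Re_le1.
  by have [+ _] := @cmeas_echar R 1; under eq_fun do rewrite echar1.
have bY : bounded_meas (fun z : S1 => Im (z : R[i])).
  split; last by exists 1; exact: circle_Im_le1.
  by have [_ +] := @cmeas_echar R 1; under eq_fun do rewrite echar1.
have wm n z : w (n - 1) z = (z : R[i]) * w n z.
  by rewrite /w !echarNJ opprB addrC echarD echar1; ring.
have wp n z : w (n + 1) z = (z : R[i])^* * w n z.
  by rewrite /w !echarNJ opprD addrC echarD -(echarNJ 1) echar1; ring.
have ReM1 (s t : R[i]) : Re s * Re t = 2^-1 * Re (s * t) + 2^-1 * Re (s^* * t).
  by rewrite conjCE; case: s => ? ?; case: t => ? ? /=; field.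
have ReM2 (s t : R[i]) : Re s * Im t = 2^-1 * Im (s * t) + 2^-1 * Im (s^* * t).
  by rewrite conjCE; case: s => ? ?; case: t => ? ? /=; field.
have ImM1 (s t : R[i]) : Im s * Re t = 2^-1 * Im (s * t) + (- 2^-1) * Im (s^* * t).
  by rewrite conjCE; case: s => ? ?; case: t => ? ? /=; field.
have ImM2 (s t : R[i]) : Im s * Im t = (- 2^-1) * Re (s * t) + 2^-1 * Re (s^* * t).
  by rewrite conjCE; case: s => ? ?; case: t => ? ? /=; field.
have mX : multiplier mu W (fun z : S1 => Re (z : R[i])).
  apply: (multiplier_of_span iW) => // _ [n [->|->]].
    exists 2^-1, 2^-1, (fun z => Re (w (n - 1) z)), (fun z => Re (w (n + 1) z)).
    by split=> [||z]; [exists (n - 1); left|exists (n + 1); left|rewrite wm wp].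
  exists 2^-1, 2^-1, (fun z => Im (w (n - 1) z)), (fun z => Im (w (n + 1) z)).
  by split=> [||z]; [exists (n - 1); right|exists (n + 1); right|rewrite wm wp].
have mY : multiplier mu W (fun z : S1 => Im (z : R[i])).
  apply: (multiplier_of_span iW) => // _ [n [->|->]].
    exists 2^-1, (- 2^-1), (fun z => Im (w (n - 1) z)), (fun z => Im (w (n + 1) z)).
    by split=> [||z]; [exists (n - 1); right|exists (n + 1); right|rewrite wm wp].
  exists (- 2^-1), 2^-1, (fun z => Re (w (n - 1) z)), (fun z => Re (w (n + 1) z)).
  by split=> [||z]; [exists (n - 1); left|exists (n + 1); left|rewrite wm wp].
have ray (p : S1 -> R) : multiplier mu W p -> (forall z, `|p z| <= 1) ->
    forall x, multiplier_sets mu W [set z | p z < x].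
  move=> mp p1 x; split; last exact: (multiplier_lt iW).
  rewrite -[X in measurable X]setTI (_ : [set z | p z < x] = p @^-1` `]-oo, x[).
    by apply: mp.1.1 => //; exact: measurable_itv.
  by apply/seteqP; split => z /=; rewrite in_itv.
have sub := circle_measurable_sub (sigma_algebra_multiplier_sets iW)
  (ray _ mX (@circle_Re_le1 R)) (ray _ mY (@circle_Im_le1 R)).
(* The vanishing of the coefficients says exactly that the constant 1 kills [W]; every indicator,
   being a multiplier, then kills [W] as well. *)
have a1 : annihilator mu W (cst 1).
  split; first exact: bounded_meas_cst.
  move=> v [n hv]; have := f0 n; rewrite fourierE /inner /circle_integral => -[h1 h2].
  by under eq_Rintegral do rewrite mul1r; case: hv => ->.
have int0 v : W v -> \forall z \ae mu, v z = 0.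
  move=> Wv; apply: ae_eq0_of_set_integrals; first exact: iW.
  move=> A mA; have [_ hA] := sub _ mA.
  have [_ h] := hA.2 _ a1; rewrite -[RHS](h _ Wv).
  by apply: eq_Rintegral => z _; rewrite mulr1.
have w0 z : w 0 z = f z by rewrite /w echar0 rmorph1 mulr1.
have h1 : W (fun z => Re (w 0 z)) by exists 0; left.
have h2 : W (fun z => Im (w 0 z)) by exists 0; right.
apply: filterS2 (int0 _ h1) (int0 _ h2) => z; rewrite w0.
by move=> r0 i0; apply: complex_eq.
Qed.

Lemma H2_L2 f : H2 f -> L2 f. Proof. by case. Qed.
Lemma H2perp_L2 f : H2perp f -> L2 f. Proof. by case. Qed.

Lemma H2P f : H2 f <-> L2 f /\ forall n, n < 0 -> inner f (echar n) = 0.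
Proof. by split=> -[Lf h]; split => // n n0; have := h _ n0; rewrite fourierE. Qed.

Lemma H2_echar (n : int) : 0 <= n -> H2 (@echar R n).
Proof.
move=> n0; apply/H2P; split; first exact: L2_echar.
by move=> m m0; apply: inner_echar; rewrite gt_eqF// (lt_le_trans m0).
Qed.

Lemma H2perp_echar (n : int) : n < 0 -> H2perp (@echar R n).
Proof.
move=> n0; split; first exact: L2_echar.
move=> h /H2P[Lh h0]; rewrite (innerC Lh (L2_echar _ n)) h0//.
exact: rmorph0.
Qed.

Lemma H2D f g : H2 f -> H2 g -> H2 (fun z => f z + g z).
Proof.
move=> /H2P[Lf f0] /H2P[Lg g0]; apply/H2P; split; first exact: L2D.
by move=> n n0; rewrite innerDl ?f0 ?g0 ?addr0//; exact: L2_echar.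
Qed.

Lemma H2Z c f : H2 f -> H2 (fun z => c * f z).
Proof.
move=> /H2P[Lf f0]; apply/H2P; split; first exact: L2Z.
by move=> n n0; rewrite innerZl ?f0 ?mulr0//; exact: L2_echar.
Qed.

Lemma H2_ae f g : cmeas g -> (\forall z \ae mu, g z = f z) -> H2 f -> H2 g.
Proof.
move=> mg gf /H2P[Lf f0]; apply/H2P; split; first exact: L2_ae gf Lf.
move=> n n0; rewrite -(f0 _ n0); apply: inner_ae => //.
- exact: L2_cmeas.
- exact: cmeas_echar.
- exact: cmeas_echar.
- exact: nearW.
Qed.

Lemma H2perpD f g : H2perp f -> H2perp g -> H2perp (fun z => f z + g z).
Proof.
move=> [Lf f0] [Lg g0]; split; first exact: L2D.
by move=> h Hh; rewrite innerDl ?f0 ?g0 ?addr0//; exact: H2_L2.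
Qed.

Lemma H2perpZ c f : H2perp f -> H2perp (fun z => c * f z).
Proof.
move=> [Lf f0]; split; first exact: L2Z.
by move=> h Hh; rewrite innerZl ?f0 ?mulr0//; exact: H2_L2.
Qed.

Lemma H2perp_ae f g : cmeas g -> (\forall z \ae mu, g z = f z) -> H2perp f -> H2perp g.
Proof.
move=> mg gf [Lf f0]; split; first exact: L2_ae gf Lf.
move=> h Hh; rewrite -(f0 _ Hh); have mh := L2_cmeas (H2_L2 Hh); apply: inner_ae => //.
- exact: L2_cmeas.
- exact: nearW.
Qed.

Lemma H2_H2perp_eq0 f : H2 f -> H2perp f -> \forall z \ae mu, f z = 0.
Proof.
move=> Hf [Lf f0]; apply: sqn_eq0 => //; by rewrite /sqn f0.
Qed.

(** [H2] is the orthogonal complement of the negative characters, so the projection theorem applies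
    to it. *)
Lemma projP_ex f : L2 f -> exists h, H2 h /\ H2perp (f \- h).
Proof.
move=> Lf; pose U := [set u : S1 -> R[i] | exists2 n : int, n < 0 & u = echar n].
have UL : U `<=` @L2 R by move=> _ [n _ ->]; exact: L2_echar.
have PU h : perp U h <-> H2 h.
  rewrite H2P; split=> -[Lh h0]; split => //.
    by move=> n n0; apply: h0; exists n.
  by move=> _ [n n0 ->]; exact: h0.
have [h /PU Hh hP] := hilbert_projection UL Lf.
exists h; split => //; split; first exact: L2B Lf (H2_L2 Hh).
by move=> g /PU; exact: hP.
Qed.

Lemma projP_spec f : L2 f -> H2 (projP f) /\ H2perp (projQ f).
Proof. by move=> Lf; have := xgetPex (cst 0) (projP_ex Lf). Qed.

(** The difference of two decompositions lies in both [H2] and [H2perp], hence vanishes almost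
    everywhere. The representative chosen by [xget] therefore does not matter. *)
Lemma projP_unique f h r : L2 f -> H2 h -> H2perp r ->
  (\forall z \ae mu, f z = h z + r z) -> \forall z \ae mu, projP f z = h z.
Proof.
move=> Lf Hh Hr fhr; have [HP HQ] := projP_spec Lf.
have H1 : H2 (fun z => projP f z + (-1) * h z) by apply: H2D => //; exact: H2Z.
have K1 : H2perp (fun z => r z + (-1) * projQ f z) by apply: H2perpD => //; exact: H2perpZ.
have K2 : H2perp (fun z => projP f z + (-1) * h z).
  apply: H2perp_ae K1; first exact: L2_cmeas (H2_L2 H1).
  by apply: filterS fhr => z e; rewrite /projQ /= e; ring.
apply: filterS (H2_H2perp_eq0 H1 K2) => z /eqP.
by rewrite mulN1r subr_eq0 => /eqP.
Qed.

(* Once [g] is projected onto the double orthogonal complement of the analytic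
   characters, the remainder has no Fourier coefficient left. *)
Lemma H2_inner_eq0 g u : H2 g -> L2 u ->
  (forall n : int, 0 <= n -> inner u (echar n) = 0) -> inner g u = 0.
Proof.
move=> /H2P[Lg g0] Lu u0.
pose V := [set v : S1 -> R[i] | L2 v /\ forall n : int, 0 <= n -> inner v (echar n) = 0].
have VL : V `<=` @L2 R by move=> v [].
have [k [Lk k0] kP] := hilbert_projection VL Lg.
have Lgk : L2 (fun z => g z - k z) by exact: L2B.
have gk : \forall z \ae mu, g z - k z = 0.
  (* Characters of nonnegative index belong to [perp V], to which [g - k] is orthogonal; those of
     negative index belong to [V], and both [g] and [k] are orthogonal to them. *)
  apply: fourier_complete => // n; rewrite fourierE; have [n0|n0] := leP 0 n.
    apply: kP; split; first exact: L2_echar.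
    move=> v [Lv v0]; rewrite (innerC Lv (L2_echar _ n)) v0//; exact: rmorph0.
  have Le := @L2_echar R n.
  rewrite innerBl// g0// k0 ?subr0//; split => // m m0.
  by apply: inner_echar; rewrite lt_eqF// (lt_le_trans n0).
rewrite -(k0 u)//; apply: inner_ae; try exact: L2_cmeas.
  by apply: filterS gk => z /eqP; rewrite subr_eq0 => /eqP.
exact: nearW.
Qed.

(** Moving [a] to the other side, [a h] is orthogonal to [e_n], for [n < 0], as soon as [h] is
    orthogonal to [conj(a) e_n]. The latter has coefficient [conj <a, e_(n-k)>] at [k >= 0], which
    is 0 because [n - k < 0], and [H2_inner_eq0] applies. *)
Lemma H2M a h : Loo a -> H2 a -> H2 h -> H2 (fun z => a z * h z).
Proof.
move=> La Ha Hh; have Lh := H2_L2 Hh; apply/H2P; split; first exact: L2_Loo.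
move=> n n0.
have -> : (fun z => a z * h z) = (fun z => h z * a z).
  by apply/funext => z; rewrite mulrC.
have -> : inner (fun z => h z * a z) (echar n) = inner h (fun z => (a z)^* * echar n z).
  rewrite -inner_adj; congr inner; apply/funext => z; exact: mulrC.
have LJ : Loo (fun z => (a z)^*) by exact: LooJ.
apply: H2_inner_eq0 => //; first exact: (L2_Loo LJ (L2_echar _ n)).
move=> k k0; have /H2P[La2 a0] := Ha.
have -> : inner (fun z => (a z)^* * echar n z) (echar k) =
    (inner a (echar (n - k)))^*.
  rewrite -innerC//; last exact: L2_echar.
  rewrite /inner; congr circle_integral; apply/funext => z.
  by rewrite echarNJ echarD -echarNJ echarNJ; ring.
rewrite a0 ?rmorph0// subr_lt0; exact: lt_le_trans k0.
Qed.

Lemma H2perpM b r : Loo b -> coanalytic b -> H2perp r ->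
  H2perp (fun z => b z * r z).
Proof.
move=> Lb Hb [Lr r0]; split; first exact: L2_Loo.
by move=> h Hh; rewrite inner_adj; apply: r0; apply: H2M => //; exact: LooJ.
Qed.

Lemma inner_echar_shift m n f :
  inner (fun z => echar m z * f z) (echar n) = inner f (echar (n - m)).
Proof.
rewrite inner_adj; congr inner; apply/funext => z.
by rewrite echarNJ -echarD addrC.
Qed.

Lemma inner_echar_diag (n : int) : inner (@echar R n) (echar n) = 1.
Proof.
have -> : inner (@echar R n) (echar n) = circle_integral (fun=> 1).
  by congr circle_integral; apply/funext => z; rewrite echarNJ -echarD subrr echar0.
rewrite /circle_integral /= !Rintegral_cst//= probability_setT /=.
by rewrite mulr1 mul0r.
Qed.

Lemma H2_mul_echar1 h : H2 h -> H2 (fun z => echar 1 z * h z).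
Proof. by apply: H2M; [exact: Loo_echar|exact: H2_echar]. Qed.

Lemma H2_backward_shift h : H2 h ->
  H2 (fun z => echar (-1) z * (h z - inner h (echar 0))).
Proof.
move=> /H2P[Lh h0]; set c := inner h _.
have Lc : L2 (fun z : S1 => c * echar 0 z) by apply: L2Z; exact: L2_echar.
have -> : (fun z => echar (-1) z * (h z - c)) =
    (fun z => echar (-1) z * (h z - c * echar 0 z)).
  by apply/funext => z; rewrite echar0 mulr1.
apply/H2P; split; first by apply: L2_Loo; [exact: Loo_echar|exact: L2B].
move=> n n0; rewrite inner_echar_shift opprK innerBl//; last exact: L2_echar.
rewrite innerZl; [|exact: L2_echar|exact: L2_echar].
(* Index -1 is where the constant coefficient of [h] lands, and where subtracting [c] matters. *)
have [->|n1] := eqVneq n (-1).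
  by rewrite addNr inner_echar_diag mulr1 subrr.
have n10 : n + 1 < 0 by rewrite lt_neqAle addr_eq0 n1 lezD1 n0.
by rewrite h0// inner_echar ?mulr0 ?subr0// gt_eqF.
Qed.

Lemma H2perp_mul_echarN1 r : H2perp r -> H2perp (fun z => echar (-1) z * r z).
Proof.
move=> [Lr r0]; split; first exact: (L2_Loo (Loo_echar _ _)).
move=> h Hh; rewrite inner_adj; apply: r0.
have := H2_mul_echar1 Hh; congr H2; apply/funext => z.
by rewrite echarNJ opprK.
Qed.

(** Multiplication by [z] moves only the coefficient of index -1 out of the negative range, to index
    0, where [c] removes it. Orthogonality to [h] reduces to orthogonality of [r] to the backward
    shift of [h]. *)
Lemma H2perp_forward_shift r : H2perp r ->
  H2perp (fun z => echar 1 z * r z - inner r (echar (-1))).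
Proof.
move=> [Lr r0]; set c := inner r _.
have Le n := @L2_echar R n.
have Ls : L2 (fun z => echar 1 z * r z) by exact: (L2_Loo (Loo_echar _ _)).
have Lc : L2 (fun z : S1 => c * echar 0 z) by exact: L2Z.
have -> : (fun z => echar 1 z * r z - c) = (fun z => echar 1 z * r z - c * echar 0 z).
  by apply/funext => z; rewrite echar0 mulr1.
split; first exact: L2B.
move=> h Hh; have Lh := H2_L2 Hh; have Hs := H2_backward_shift Hh.
set c0 := inner h (echar 0) in Hs.
rewrite innerBl// innerZl// inner_adj (innerC Lh (Le 0)) -/c0.
have -> : (fun z => (echar 1 z)^* * h z) =
    (fun z => echar (-1) z * (h z - c0) + c0 * echar (-1) z).
  by apply/funext => z; rewrite echarNJ; ring.
rewrite innerDr ?(r0 _ Hs)//; [|exact: H2_L2|exact: L2Z].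
by rewrite innerZr// -/c add0r mulrC subrr.
Qed.

End Hardy.

(** * Products of singular integral operators *)

Section Products.
Variable R : realType.
Local Notation S1 := (circle R).
Local Notation mu := (@circle_measure R).
Implicit Types (f g h r a b : S1 -> R[i]) (c : R[i]) (z : S1).

(** Allows [Sop] to be evaluated on any explicit decomposition instead of the chosen projections. *)
Lemma Sop_ae a b f h r : L2 f -> H2 h -> H2perp r ->
  (\forall z \ae mu, f z = h z + r z) ->
  \forall z \ae mu, Sop a b f z = a z * h z + b z * r z.
Proof.
move=> Lf Hh Hr fhr; apply: filterS2 fhr (projP_unique Lf Hh Hr fhr) => z e Pz.
by rewrite /Sop /= /projQ /= Pz e; ring.
Qed.

Lemma L2_Sop a b f : Loo a -> Loo b -> L2 f -> L2 (Sop a b f).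
Proof.
move=> La Lb /projP_spec[/H2_L2 LP /H2perp_L2 LQ].
by apply: L2D; exact: L2_Loo.
Qed.

Lemma projPQ f z : f z = projP f z + projQ f z.
Proof. by rewrite /projQ /= addrC subrK. Qed.

Lemma H2_cst0 : H2 (fun=> 0 : R[i]).
Proof.
have := H2Z 0 (H2_echar R (lexx 0)); congr H2.
by apply/funext => z; rewrite mul0r.
Qed.

Lemma H2perp_cst0 : H2perp (fun=> 0 : R[i]).
Proof. by split=> [|h _]; [exact: L2_cst0|exact: inner0l]. Qed.

(** * Necessity of the conditions and determination of the symbols *)

Section Necessity.
Variables a1 b1 a2 b2 a b : S1 -> R[i].
Hypotheses (La2 : Loo a2) (Lb2 : Loo b2).
Hypothesis eqS : eq_on_L2 (Sop a1 b1 \o Sop a2 b2) (Sop a b).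

(** On [H2] the operators [Sop a2 b2] and [Sop a b] are multiplications by [a2] and [a], so a
    decomposition of [a2 f] makes the operator identity pointwise. *)
Lemma Sop_comp_H2 f h r : H2 f -> H2 h -> H2perp r ->
  (forall z, a2 z * f z = h z + r z) ->
  \forall z \ae mu, a z * f z = a1 z * h z + b1 z * r z.
Proof.
move=> Hf Hh Hr e; have Lf := H2_L2 Hf.
have ef : \forall z \ae mu, f z = f z + (fun=> 0) z by apply: nearW => z; rewrite addr0.
have S2 := Sop_ae a2 b2 Lf Hf H2perp_cst0 ef.
have S0 := Sop_ae a b Lf Hf H2perp_cst0 ef.
have e2 : \forall z \ae mu, Sop a2 b2 f z = h z + r z.
  by apply: filterS S2 => z ->; rewrite -e mulr0 addr0.
have S12 := Sop_ae a1 b1 (L2_Sop La2 Lb2 Lf) Hh Hr e2.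
have /aeqP E := eqS Lf.
by apply: filterS3 S0 S12 E => z; rewrite /= mulr0 addr0 => <- <- ->.
Qed.

Lemma Sop_comp_H2perp f h r : H2perp f -> H2 h -> H2perp r ->
  (forall z, b2 z * f z = h z + r z) ->
  \forall z \ae mu, b z * f z = a1 z * h z + b1 z * r z.
Proof.
move=> Hf Hh Hr e; have Lf := H2perp_L2 Hf.
have ef : \forall z \ae mu, f z = (fun=> 0) z + f z by apply: nearW => z; rewrite add0r.
have S2 := Sop_ae a2 b2 Lf H2_cst0 Hf ef.
have S0 := Sop_ae a b Lf H2_cst0 Hf ef.
have e2 : \forall z \ae mu, Sop a2 b2 f z = h z + r z.
  by apply: filterS S2 => z ->; rewrite -e mulr0 add0r.
have S12 := Sop_ae a1 b1 (L2_Sop La2 Lb2 Lf) Hh Hr e2.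
have /aeqP E := eqS Lf.
by apply: filterS3 S0 S12 E => z; rewrite /= mulr0 add0r => <- <- ->.
Qed.

Lemma cst_eq0_of_ae c : ~ (\forall z \ae mu, a1 z = b1 z) ->
  (\forall z \ae mu, (a1 z - b1 z) * c = 0) -> c = 0.
Proof.
move=> nab h; apply/eqP/negP => /negP c0; apply: nab.
apply: filterS h => z /eqP; rewrite mulf_eq0 (negbTE c0) orbF subr_eq0.
by move=> /eqP.
Qed.

Lemma analytic_of_product : ~ (\forall z \ae mu, a1 z = b1 z) -> analytic a2.
Proof.
move=> nab; have LL := LooL2 La2; have [HP HQ] := projP_spec LL.
set p := projP a2 in HP; set g := projQ a2 in HQ.
have pg z : a2 z = p z + g z by exact: projPQ.
have step (n : nat) : H2perp (fun z => echar n z * g z) ->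
    inner (fun z => echar n z * g z) (echar (-1)) = 0.
  move=> Hr; set c := inner _ _.
  have Hp : H2 (fun z => echar n z * p z).
    by apply: H2M => //; [exact: Loo_echar|exact: H2_echar].
  (* After multiplication by [z] the term [c] passes from the [H2perp] part to the [H2] part, so its
     factor changes from [b1] to [a1]. *)
  have Hp1 : H2 (fun z => echar 1 z * (echar n z * p z) + c * echar 0 z).
    by apply: H2D; [exact: H2_mul_echar1|apply: H2Z; exact: H2_echar].
  have k1 := Sop_comp_H2 (@H2_echar R n isT) Hp Hr.
  have {}k1 := k1 (fun z => etrans (mulrC _ _) (etrans (congr1 _ (pg z)) (mulrDr _ _ _))).
  have k2 : \forall z \ae mu, a z * echar (1 + n%:Z) z =
      a1 z * (echar 1 z * (echar n z * p z) + c * echar 0 z) +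
      b1 z * (echar 1 z * (echar n z * g z) - c).
    apply: Sop_comp_H2 => //; [exact: H2_echar|exact: H2perp_forward_shift|].
    by move=> z; rewrite pg echar0 echarD; ring.
  apply: (cst_eq0_of_ae nab); apply: filterS2 k1 k2 => z e1.
  rewrite echarD echar0 mulr1 => e2.
  (* Subtracting [z] times the identity for [e_n] from the one for [e_(n+1)] eliminates [a] and
     leaves only the term that changed sides. *)
  have -> : (a1 z - b1 z) * c =
    (a1 z * (echar 1 z * (echar n z * p z) + c) +
      b1 z * (echar 1 z * (echar n z * g z) - c)) -
    echar 1 z * (a1 z * (echar n z * p z) + b1 z * (echar n z * g z)) by ring.
  by rewrite -e1 -e2; ring.
have Hr (n : nat) : H2perp (fun z => echar n z * g z).
  elim: n => [|n IH].
    by move: HQ; congr H2perp; apply/funext => z; rewrite echar0 mul1r.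
  have := H2perp_forward_shift IH; rewrite step//; congr H2perp.
  by apply/funext => z; rewrite subr0 mulrA -echarD -PoszD add1n.
have g0 : \forall z \ae mu, g z = 0.
  apply: fourier_complete; first exact: H2perp_L2.
  move=> n; rewrite fourierE; have [n0|n0] := leP 0 n.
    by apply: HQ.2; exact: H2_echar.
  (* The coefficient of [g] at [-(n+1)] is that of [z^n g] at -1. *)
  case: n n0 => // n _; have := step n (Hr n); rewrite inner_echar_shift.
  by rewrite NegzE -opprD -PoszD add1n.
apply: H2_ae HP; first exact: Loo_cmeas.
by apply: filterS g0 => z e; rewrite pg e addr0.
Qed.

Lemma coanalytic_of_H2perp : H2perp (fun z => b2 z * echar (-1) z) -> coanalytic b2.
Proof.
move=> [_ h0]; have Lb := LooL2 Lb2; apply/H2P; split; first exact: L2J.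
(* The coefficient of [conj(b2)] at [n] is conjugate to that of [b2 e_(-1)] at [-n - 1], an index
   that is nonnegative exactly when [n < 0]. *)
move=> n n0; have nn : 0 <= - n - 1 by rewrite -opprD oppr_ge0 lezD1.
have e := h0 _ (H2_echar R nn).
have -> : inner (fun z => (b2 z)^*) (echar n) =
    (inner (fun z => b2 z * echar (-1) z) (echar (- n - 1)))^*.
  rewrite -innerC; [|by apply: L2_Loo => //; exact: L2_echar|exact: L2_echar].
  congr circle_integral; apply/funext => z.
  rewrite rmorphM /= !echarNJ opprK mulrCA -echarD; congr (_ * echar _ z); ring.
by rewrite e; exact: rmorph0.
Qed.

(** Mirror image of [analytic_of_product]. The characters of [H2perp] start at [e_(-1)], so
    [b2 e_(-1)] is decomposed; multiplication by [e_(-1)] preserves [H2perp], and the constant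
    coefficient [c] of the [H2] part is what changes sides. *)
Lemma coanalytic_of_product : ~ (\forall z \ae mu, a1 z = b1 z) -> coanalytic b2.
Proof.
move=> nab; have LL : L2 (fun z => b2 z * echar (-1) z).
  by apply: L2_Loo => //; exact: L2_echar.
have [HP HQ] := projP_spec LL.
set h := projP _ in HP; set q := projQ _ in HQ.
have hq z : b2 z * echar (-1) z = h z + q z by exact: (projPQ (fun z => b2 z * echar (-1) z)).
have eS (n : nat) z : echar (- n.+1%:Z) z = echar (-1) z * echar (- n%:Z) z.
  by rewrite -echarD -opprD -PoszD add1n.
have Hq (n : nat) : H2perp (fun z => echar (- n%:Z) z * q z).
  elim: n => [|n IH].
    by move: HQ; congr H2perp; apply/funext => z; rewrite oppr0 echar0 mul1r.
  have := H2perp_mul_echarN1 IH; congr H2perp.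
  by apply/funext => z; rewrite mulrA eS.
have step (n : nat) : H2 (fun z => echar (- n%:Z) z * h z) ->
    inner (fun z => echar (- n%:Z) z * h z) (echar 0) = 0.
  move=> Hh; set c := inner _ _.
  have Hq1 : H2perp (fun z => echar (- n.+1%:Z) z * q z + c * echar (-1) z).
    by apply: H2perpD; [exact: Hq|apply: H2perpZ; exact: H2perp_echar].
  have k1 : \forall z \ae mu, b z * echar (- n.+1%:Z) z =
      a1 z * (echar (- n%:Z) z * h z) + b1 z * (echar (- n%:Z) z * q z).
    apply: Sop_comp_H2perp => //; first exact: H2perp_echar.
    by move=> z; rewrite eS mulrA hq; ring.
  have k2 : \forall z \ae mu, b z * echar (- n.+2%:Z) z =
      a1 z * (echar (-1) z * (echar (- n%:Z) z * h z - c)) +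
      b1 z * (echar (- n.+1%:Z) z * q z + c * echar (-1) z).
    apply: Sop_comp_H2perp => //; [exact: H2perp_echar|exact: H2_backward_shift|].
    by move=> z; rewrite (eS n.+1) [LHS]mulrA hq (eS n); ring.
  apply: (cst_eq0_of_ae nab); apply: filterS2 k1 k2 => z e1.
  rewrite (eS n.+1) => e2.
  (* Here [c] changes sides as [c e_(-1)], so the comparison yields the goal multiplied by this
     nonvanishing factor. *)
  apply: (mulfI (_ : echar (-1) z != 0)).
    by rewrite expfz_neq0// circle_neq0.
  have -> : echar (-1) z * ((a1 z - b1 z) * c) =
    echar (-1) z * (a1 z * (echar (- n%:Z) z * h z) + b1 z * (echar (- n%:Z) z * q z)) -
    (a1 z * (echar (-1) z * (echar (- n%:Z) z * h z - c)) +
     b1 z * (echar (- n.+1%:Z) z * q z + c * echar (-1) z)).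
    by rewrite (eS n); ring.
  by rewrite -e1 -e2; ring.
have Hh (n : nat) : H2 (fun z => echar (- n%:Z) z * h z).
  elim: n => [|n IH].
    by move: HP; congr H2; apply/funext => z; rewrite oppr0 echar0 mul1r.
  have := H2_backward_shift IH; rewrite step//; congr H2.
  by apply/funext => z; rewrite subr0 mulrA eS.
have h0 : \forall z \ae mu, h z = 0.
  apply: fourier_complete; first exact: H2_L2.
  have /H2P[_ hN] := HP; move=> n; rewrite fourierE; have [n0|/hN//] := leP 0 n.
  case: n n0 => // n _; have := step n (Hh n).
  by rewrite inner_echar_shift sub0r opprK.
apply: coanalytic_of_H2perp; apply: H2perp_ae HQ; first exact: L2_cmeas.
by apply: filterS h0 => z e; rewrite hq e add0r.
Qed.

Lemma H2perp_of_coanalytic : coanalytic b2 -> H2perp (fun z => b2 z * echar (-1) z).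
Proof. by move=> Hb; apply: H2perpM => //; exact: H2perp_echar. Qed.

Lemma product_dichotomy : (\forall z \ae mu, a1 z = b1 z) \/
  (analytic a2 /\ coanalytic b2).
Proof.
have [h|h] := pselect (\forall z \ae mu, a1 z = b1 z); first by left.
by right; split; [exact: analytic_of_product|exact: coanalytic_of_product].
Qed.

(** One character suffices to read off a symbol: the constant [e_0] gives [a], and in the next lemma
    [e_(-1)], which never vanishes, gives [b]. In each branch of the dichotomy the parts recombine
    into the product. *)
Lemma product_symbol_H2 : \forall z \ae mu, a z = a1 z * a2 z.
Proof.
have LL := LooL2 La2; have [HP HQ] := projP_spec LL.
have He := @H2_echar R 0 isT.
case: product_dichotomy => [ab|[Ha _]].
  have k : \forall z \ae mu, a z * echar 0 z = a1 z * projP a2 z + b1 z * projQ a2 z.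
    by apply: Sop_comp_H2 => // z; rewrite echar0 mulr1 -projPQ.
  apply: filterS2 ab k => z e; rewrite echar0 mulr1 => ->.
  by rewrite e -mulrDr -projPQ.
have k : \forall z \ae mu, a z * echar 0 z = a1 z * a2 z + b1 z * (fun=> 0) z.
  apply: Sop_comp_H2 => //; first exact: H2perp_cst0.
  by move=> z; rewrite echar0 mulr1 addr0.
by apply: filterS k => z; rewrite echar0 mulr1 mulr0 addr0.
Qed.

Lemma product_symbol_H2perp : \forall z \ae mu, b z = b1 z * b2 z.
Proof.
have LL : L2 (fun z => b2 z * echar (-1) z).
  by apply: L2_Loo => //; exact: L2_echar.
have He := @H2perp_echar R (-1) isT.
have e0 z : echar (-1) z != 0 by rewrite expfz_neq0// circle_neq0.
case: product_dichotomy => [ab|[_ /H2perp_of_coanalytic Hb]].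
  have [HP HQ] := projP_spec LL.
  have k := Sop_comp_H2perp He HP HQ (projPQ _).
  apply: filterS2 ab k => z e k; apply: (mulIf (e0 z)).
  by rewrite k -mulrA e -mulrDr -(projPQ (fun z => b2 z * echar (-1) z)).
have k : \forall z \ae mu, b z * echar (-1) z =
    a1 z * (fun=> 0) z + b1 z * (b2 z * echar (-1) z).
  apply: Sop_comp_H2perp => //; first exact: H2_cst0.
  by move=> z; rewrite add0r.
apply: filterS k => z; rewrite mulr0 add0r mulrA; exact: mulIf.
Qed.

End Necessity.

(** If [a1 = b1], the outer operator is multiplication by [a1]. Otherwise [a2 P f] stays in [H2] and
    [b2 Q f] in [H2perp], so they decompose [Sop a2 b2 f]. *)
Lemma product_eqS a1 b1 a2 b2 : Loo a2 -> Loo b2 ->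
  (\forall z \ae mu, a1 z = b1 z) \/ (analytic a2 /\ coanalytic b2) ->
  eq_on_L2 (Sop a1 b1 \o Sop a2 b2) (Sop (a1 \* a2) (b1 \* b2)).
Proof.
move=> La2 Lb2 hyp f Lf; apply/aeqP; case: hyp => [ab|[Ha Hb]].
  apply: filterS ab => z e; rewrite /= [LHS]/Sop /= e -mulrDr -projPQ.
  by rewrite /Sop /= e mulrDr !mulrA.
have [HP HQ] := projP_spec Lf.
have e : \forall z \ae mu, Sop a2 b2 f z = a2 z * projP f z + b2 z * projQ f z.
  exact: nearW.
have S12 := Sop_ae a1 b1 (L2_Sop La2 Lb2 Lf) (H2M La2 Ha HP) (H2perpM Lb2 Hb HQ) e.
by apply: filterS S12 => z; rewrite /= => ->; rewrite /Sop /= !mulrA.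
Qed.
End Products.

Local Close Scope classical_set_scope.

Theorem theorem6p1 (R : realType)
    (alpha1 beta1 alpha2 beta2 : circle R -> R[i])
    (Halpha1 : Loo alpha1) (Hbeta1 : Loo beta1)
    (Halpha2 : Loo alpha2) (Hbeta2 : Loo beta2) :
  ((exists alpha beta : circle R -> R[i],
      [/\ Loo alpha, Loo beta &
          eq_on_L2 (Sop alpha1 beta1 \o Sop alpha2 beta2) (Sop alpha beta)])
   <->
   (alpha1 = beta1 %[ae @circle_measure R] \/
    (analytic alpha2 /\ coanalytic beta2)))
  /\
  (forall alpha beta : circle R -> R[i],
     Loo alpha -> Loo beta ->
     eq_on_L2 (Sop alpha1 beta1 \o Sop alpha2 beta2) (Sop alpha beta) ->
     alpha = (alpha1 \* alpha2) %[ae @circle_measure R] /\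
     beta = (beta1 \* beta2) %[ae @circle_measure R]).
Proof.
split; last first.
  move=> alpha beta _ _ eqS.
  by split; apply/aeqP; [exact: product_symbol_H2 eqS|exact: product_symbol_H2perp eqS].
split=> [[alpha [beta [_ _ eqS]]]|hyp].
  have [/aeqP ab|h] := product_dichotomy Halpha2 Hbeta2 eqS; first by left.
  by right.
exists (alpha1 \* alpha2), (beta1 \* beta2); split; [exact: LooM|exact: LooM|].
by apply: product_eqS => //; case: hyp => [/aeqP|]; [left|right].
Qed.
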